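(* Let $\mathcal{M}$ be a family of axisymmetric metrics with nonnegative scalar curvature which is uniformly asymptotically flat outside of radius $R_0$. Suppose that $\mathcal{M}$ is radially monotone and that for all $g\in\mathcal{M}$ one has $A=B=0$ in the cylindrical coordinate expression. Let $R_1>R_0$ and let $A(R_0,R_1)=\{R_0<r<R_1\}$, $r=\sqrt{\rho^2+z^2}$, denote the coordinate spherical annulus centered at the origin. For any given $0<\beta<1$ and $\epsilon>0$ there exists a $\delta>0$ such that if $g\in\mathcal{M}$ and $m(g)<\delta$, then $$\|g-\delta_{\mathbb{R}^3}\|_{C^{0,\beta}(A(R_0,R_1))}<\epsilon,$$ where $\delta_{\mathbb{R}^3}$ is the Euclidean metric in the cylindrical coordinates.
   Context: Axisymmetric metrics: smooth, asymptotically flat Riemannian metrics $g$ given in global cylindrical coordinates $(\rho,z,\phi)$ on $\mathbb{R}^3$ by $g=e^{2\alpha-2u}(d\rho^2+dz^2)+\rho^2e^{-2u}(d\phi+B\,d\rho+A\,dz)^2$, where $\alpha,u,A,B$ depend only on $(\rho,z)$. The Killing field is $\eta=\partial/\partial\phi$. The ADM mass is $m(g)=\lim_{R\to\infty}\frac{1}{16\pi}\int_{S_R}(g_{ij,j}-g_{jj,i})\nu^i$; as a standing fact, $m(g)=\frac1{16\pi}\int_{\mathbb{R}^3}\Big[e^{-2(u-\alpha)}\big(R_g+\tfrac{\rho^2e^{-4\alpha+2u}}{2}(\partial_zB-\partial_\rho A)^2\big)+2|\nabla u|^2\Big]\rho\,d\rho\,dz\,d\phi$, with $R_g$ the scalar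 curvature and $|\nabla u|$ Euclidean. Uniformly asymptotically flat outside of radius $R_0$: there is a constant $C$ such that for every $g\in\mathcal{M}$ and all $r=\sqrt{\rho^2+z^2}\ge R_0$, $|\partial^I u|,|\partial^I\alpha|,|\partial^I A|,|\partial^I B|\le C/r^{1+|I|}$ for multi-indices $|I|\le 2$. Radially monotone: for each $g\in\mathcal{M}$ and every $\rho_0>0$, $\frac{\partial}{\partial\rho}\Big(\frac1\rho\frac{|\eta|_g}{|\nabla\rho|_g}\Big)\le0$ on $\{\rho=\rho_0\}$; equivalently $\partial_\rho(\alpha-2u)\le 0$ everywhere. The Hölder norm of $g-\delta_{\mathbb{R}^3}$ is that of its components in the cylindrical coordinates, with Hölder norms of functions taken with respect to the Euclidean distance on $\mathbb{R}^3$. *)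

(* Defs.v *)
From Stdlib Require Import Reals List.
From Coquelicot Require Import Coquelicot.
Open Scope R_scope.

(** * Calculus on R^3 *)

(** A point is [(x, y, z)] in Cartesian coordinates and [(rho, z, phi)] in
    cylindrical ones; [c1], [c2], [c3] index the coordinates in that order. *)
Definition point : Type := (R * R * R)%type.

Inductive ix : Set := c1 | c2 | c3.

Definition ix_eqb (i j : ix) : bool :=
  match i, j with c1, c1 | c2, c2 | c3, c3 => true | _, _ => false end.

Definition kron (i j : ix) : R := if ix_eqb i j then 1 else 0.

Definition next (i : ix) : ix :=
  match i with c1 => c2 | c2 => c3 | c3 => c1 end.

Definition sum3 (f : ix -> R) : R := f c1 + f c2 + f c3.

Definition coord (i : ix) (p : point) : R :=
  match i with c1 => fst (fst p) | c2 => snd (fst p) | c3 => snd p end.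

Definition set_coord (i : ix) (p : point) (t : R) : point :=
  match i with
  | c1 => (t, coord c2 p, coord c3 p)
  | c2 => (coord c1 p, t, coord c3 p)
  | c3 => (coord c1 p, coord c2 p, t)
  end.

Definition partial (i : ix) (f : point -> R) (p : point) : R :=
  Derive (fun t => f (set_coord i p t)) (coord i p).

Fixpoint partials (I : list ix) (f : point -> R) : point -> R :=
  match I with
  | nil => f
  | i :: I' => partial i (partials I' f)
  end.

(** [Derive] is total, so existence is required at each order. *)
Definition smooth (f : point -> R) : Prop :=
  forall I : list ix,
    (forall p : point, continuous (partials I f : R * R * R -> R) p) /\
    (forall (i : ix) (p : point),
       ex_derive (fun t => partials I f (set_coord i p t)) (coord i p)).

(** Smoothness up to the boundary of the half-plane [rho >= 0]; the values at
    [rho < 0] are unconstrained. *)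
Definition smooth_halfplane (f : R -> R -> R) : Prop :=
  exists F : R -> R -> R,
    smooth (fun p => F (coord c1 p) (coord c2 p)) /\
    forall rho z, 0 <= rho -> F rho z = f rho z.

Definition enorm (p : point) : R := sqrt (sum3 (fun i => coord i p ^ 2)).

Definition edist (p q : point) : R :=
  sqrt (sum3 (fun i => (coord i p - coord i q) ^ 2)).

(** * Riemannian geometry in a coordinate chart *)

Definition tensor2 : Type := ix -> ix -> point -> R.

Definition riemannian (g : tensor2) : Prop :=
  (forall i j, smooth (g i j)) /\
  (forall i j p, g i j p = g j i p) /\
  (forall p (v : ix -> R), (exists i, v i <> 0) ->
     0 < sum3 (fun i => sum3 (fun j => g i j p * v i * v j))).

(** Cyclic indices absorb the checkerboard signs of the cofactors. *)
Definition cofactor3 (g : tensor2) (i j : ix) (p : point) : R :=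
  g (next i) (next j) p * g (next (next i)) (next (next j)) p
  - g (next i) (next (next j)) p * g (next (next i)) (next j) p.

Definition det3 (g : tensor2) (p : point) : R :=
  sum3 (fun j => g c1 j p * cofactor3 g c1 j p).

Definition ginv (g : tensor2) : tensor2 :=
  fun i j p => cofactor3 g j i p / det3 g p.

(** [christoffel g k i j] is Gamma^k_{ij}. *)
Definition christoffel (g : tensor2) (k i j : ix) (p : point) : R :=
  / 2 * sum3 (fun l => ginv g k l p *
    (partial i (g j l) p + partial j (g i l) p - partial l (g i j) p)).

Definition ricci (g : tensor2) : tensor2 := fun i j p =>
  sum3 (fun k =>
    partial k (christoffel g k i j) p - partial j (christoffel g k i k) p
    + sum3 (fun l => christoffel g k k l p * christoffel g l i j p
                     - christoffel g k j l p * christoffel g l i k p)).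

Definition scalar_curvature (g : tensor2) (p : point) : R :=
  sum3 (fun i => sum3 (fun j => ginv g i j p * ricci g i j p)).

Definition vector_norm (g : tensor2) (v : ix -> R) (p : point) : R :=
  sqrt (sum3 (fun i => sum3 (fun j => g i j p * v i * v j))).

Definition gradient_norm (g : tensor2) (f : point -> R) (p : point) : R :=
  sqrt (sum3 (fun i => sum3 (fun j => ginv g i j p * partial i f p * partial j f p))).

(** Standard asymptotic flatness in Cartesian coordinates, with some decay rate
    [tau > 1/2]. Integrability of the scalar curvature is not imposed. *)
Definition asymptotically_flat (g : tensor2) : Prop :=
  exists tau C R : R, / 2 < tau /\ 0 < R /\
    forall (a b : ix) (I : list ix) (p : point),
      (length I <= 2)%nat -> R <= enorm p ->
      Rabs (partials I (fun q => g a b q - kron a b) p)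
        <= C * Rpower (enorm p) (- (tau + INR (length I))).

Definition sphere_normal (theta phi : R) : point :=
  (sin theta * cos phi, sin theta * sin phi, cos theta).

Definition scale_point (r : R) (p : point) : point :=
  (r * coord c1 p, r * coord c2 p, r * coord c3 p).

(** The flux of [g_{ij,j} - g_{jj,i}] through [S_r], with the area element
    [r^2 sin theta dphi dtheta]. *)
Definition adm_flux (g : tensor2) (r : R) : R :=
  RInt (fun theta =>
    RInt (fun phi =>
      let nu := sphere_normal theta phi in
      let p := scale_point r nu in
      sum3 (fun i => sum3 (fun j =>
        (partial j (g i j) p - partial i (g j j) p) * coord i nu))
      * (r ^ 2 * sin theta)) 0 (2 * PI)) 0 PI.

Definition adm_mass (g : tensor2) : Rbar :=
  Lim (fun r => / (16 * PI) * adm_flux g r) p_infty.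

(** * Axisymmetric metrics *)

(** The components of
    [e^(2 alpha - 2 u) (drho^2 + dz^2) + rho^2 e^(-2 u) (dphi + B drho + A dz)^2]
    in the coordinates [(rho, z, phi)]. *)
Definition cyl_metric (alpha u A B : R -> R -> R) (i j : ix) (rho z : R) : R :=
  let form (k : ix) := match k with c1 => B rho z | c2 => A rho z | c3 => 1 end in
  exp (2 * alpha rho z - 2 * u rho z) * (kron i c1 * kron j c1 + kron i c2 * kron j c2)
  + rho ^ 2 * exp (- 2 * u rho z) * (form i * form j).

(** [drho^2 + dz^2 + rho^2 dphi^2]. *)
Definition cyl_euclid (i j : ix) (rho z : R) : R :=
  kron i c1 * kron j c1 + kron i c2 * kron j c2 + rho ^ 2 * (kron i c3 * kron j c3).

Definition rho_of (p : point) : R := sqrt (coord c1 p ^ 2 + coord c2 p ^ 2).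

Definition z_of (p : point) : R := coord c3 p.

(** [cyl_jac i a p] is the [a]-th Cartesian partial derivative, at a point [p]
    off the axis, of the [i]-th of [rho], [z], [phi]. *)
Definition cyl_jac (i a : ix) (p : point) : R :=
  match i, a with
  | c1, c1 => coord c1 p / rho_of p
  | c1, c2 => coord c2 p / rho_of p
  | c1, c3 => 0
  | c2, c3 => 1
  | c2, _ => 0
  | c3, c1 => - coord c2 p / rho_of p ^ 2
  | c3, c2 => coord c1 p / rho_of p ^ 2
  | c3, c3 => 0
  end.

(** The cylindrical chart degenerates on the axis, so the metric on R^3 is given
    by its Cartesian components [cart], which are smooth across the axis and
    determined off the axis by [alpha], [u], [A], [B]. *)
Record axisym_metric : Type := {
  alpha : R -> R -> R;
  u : R -> R -> R;
  A : R -> R -> R;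
  B : R -> R -> R;
  cart : tensor2;
  alpha_smooth : smooth_halfplane alpha;
  u_smooth : smooth_halfplane u;
  A_smooth : smooth_halfplane A;
  B_smooth : smooth_halfplane B;
  cart_riemannian : riemannian cart;
  cart_cyl : forall (a b : ix) (p : point), 0 < rho_of p ->
    cart a b p = sum3 (fun i => sum3 (fun j =>
      cyl_metric alpha u A B i j (rho_of p) (z_of p) * cyl_jac i a p * cyl_jac j b p));
  cart_flat : asymptotically_flat cart
}.

Definition cyl (g : axisym_metric) : ix -> ix -> R -> R -> R :=
  cyl_metric (alpha g) (u g) (A g) (B g).

(** The metric in the chart [(rho, z, phi)], meaningful for [rho > 0]. *)
Definition cyl_tensor (g : axisym_metric) : tensor2 :=
  fun i j p => cyl g i j (coord c1 p) (coord c2 p).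

(** At the axis this extends by continuity. *)
Definition nonneg_scalar_curvature (g : axisym_metric) : Prop :=
  forall p : point, 0 < coord c1 p -> 0 <= scalar_curvature (cyl_tensor g) p.

Definition mass (g : axisym_metric) : Rbar := adm_mass (cart g).

Definition d_rho_z (a b : nat) (f : R -> R -> R) (rho z : R) : R :=
  Derive_n (fun s => Derive_n (f s) b z) a rho.

(** The bounds at [rho = 0] follow by continuity. *)
Definition uniformly_asymptotically_flat
    (M : axisym_metric -> Prop) (R0 : R) : Prop :=
  exists C : R, forall g : axisym_metric, M g ->
    forall rho z : R, 0 < rho -> R0 <= sqrt (rho ^ 2 + z ^ 2) ->
    forall a b : nat, (a + b <= 2)%nat ->
    let bound := C / sqrt (rho ^ 2 + z ^ 2) ^ (1 + (a + b)) in
    Rabs (d_rho_z a b (u g) rho z) <= bound /\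
    Rabs (d_rho_z a b (alpha g) rho z) <= bound /\
    Rabs (d_rho_z a b (A g) rho z) <= bound /\
    Rabs (d_rho_z a b (B g) rho z) <= bound.

(** [eta = d/dphi]. *)
Definition killing_field (i : ix) : R := kron i c3.

Definition radially_monotone (M : axisym_metric -> Prop) : Prop :=
  forall g : axisym_metric, M g ->
  forall rho0 : R, 0 < rho0 ->
  forall p : point, coord c1 p = rho0 ->
    partial c1 (fun q =>
      / coord c1 q * (vector_norm (cyl_tensor g) killing_field q
                      / gradient_norm (cyl_tensor g) (coord c1) q)) p <= 0.

(** * Hölder norms *)

Definition annulus (R0 R1 : R) (p : point) : Prop := R0 < enorm p < R1.

Definition sup_norm (D : point -> Prop) (f : point -> R) : Rbar :=
  Lub_Rbar (fun v => exists p, D p /\ v = Rabs (f p)).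

Definition holder_seminorm (beta : R) (D : point -> Prop) (f : point -> R) : Rbar :=
  Lub_Rbar (fun v => exists p q, D p /\ D q /\ p <> q /\
    v = Rabs (f p - f q) / Rpower (edist p q) beta).

Definition holder_norm (beta : R) (D : point -> Prop) (f : point -> R) : Rbar :=
  Rbar_plus (sup_norm D f) (holder_seminorm beta D f).

Definition Rbar_sum3 (f : ix -> Rbar) : Rbar :=
  Rbar_plus (Rbar_plus (f c1) (f c2)) (f c3).

(** The components depend on [(rho, z)] only, and [D] is a subset of R^3 in
    Cartesian coordinates. *)
Definition holder_dist_euclid (beta : R) (D : point -> Prop) (g : axisym_metric) : Rbar :=
  Rbar_sum3 (fun i => Rbar_sum3 (fun j =>
    holder_norm beta D (fun p =>
      cyl g i j (rho_of p) (z_of p) - cyl_euclid i j (rho_of p) (z_of p)))).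

(* Main.v *)
(** Write [w = alpha - 2 u] and [Lap] for the flat Laplacian in [(rho, z)]. With [A = B = 0] and
    [rho > 0], nonnegative scalar curvature says
    [N := 4 Lap u + 4 u_rho / rho - 2 Lap alpha >= 2 |Du|^2], and radial monotonicity says
    [w_rho <= 0]. Integrating [rho N] over half-discs of radius [r], where the boundary term at
    the axis vanishes because [alpha = 0] there, gives a flux [H(r)] which is nondecreasing and
    tends to [8 m]; hence the Dirichlet energy of [u] is controlled by the mass [m].

    Since [N = -2 Lap w + 4 u_rho / rho], integrating [N] against the weight
    [rho^2 / (1 + rho^2)] over the half-disc of radius [R] bounds the weighted integral of
    [|w_rho|] by [O(1/R)], from the boundary, plus a term absorbed by the energy of [u]. Taking
    first [R] large and then [m] small makes this arbitrarily small. The uniform bounds on second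
    derivatives turn smallness of the weighted integrals of [|w_rho|] and [u_rho^2] into pointwise
    smallness of [w_rho] and [u_rho] outside radius [R0] and away from the axis. Integrating in
    from large [rho], where [u] and [w] are small by decay, shows that [u] and [alpha] are small,
    and interpolation with the uniform Lipschitz bound gives the Hölder estimate. *)

From Stdlib Require Import Reals Lra Lia.
From Coquelicot Require Import Coquelicot.
Require Import Defs.
Open Scope R_scope.

(** * Twice differentiable functions of two variables *)

(** The mass controls the Dirichlet energy of [u] but gives no direct bound on [alpha]. Monotonicity
    supplies the missing estimate: as [w_rho] has a sign, a bound on its integral is an L^1 bound.
    The obstacle is [4 u_rho / rho], which has no sign and is first order, while the mass controls
    only squares. Young's inequality therefore leaves an additive error proportional to a parameter
    [lam], which is fixed after the radius and before the mass.

    No area integrals occur. A half-disc integral is represented by a function of [r], zero at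
    [r = 0], whose derivative is an integral over the angle [0 < t < PI]; the divergence theorem
    becomes differentiation under the integral sign up to an angular derivative that integrates to
    zero. Differentiating up to the axis is possible because [u] and [alpha] extend smoothly through
    [rho = 0]. All constants are chosen before the metric, from the decay constant, [R0], [R1],
    [beta] and [eps], which makes [delta] uniform over the family. *)

Record C2 (F F1 F2 F11 F12 F22 : R -> R -> R) : Prop := {
  C2_d : forall x y, differentiable_pt_lim F x y (F1 x y) (F2 x y);
  C2_d1 : forall x y, differentiable_pt_lim F1 x y (F11 x y) (F12 x y);
  C2_d2 : forall x y, differentiable_pt_lim F2 x y (F12 x y) (F22 x y);
  C2_c11 : forall x y, continuity_2d_pt F11 x y;
  C2_c12 : forall x y, continuity_2d_pt F12 x y;
  C2_c22 : forall x y, continuity_2d_pt F22 x y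
}.

Lemma differentiable_pt_lim_continuity F x y lx ly :
  differentiable_pt_lim F x y lx ly -> continuity_2d_pt F x y.
Proof.
  intros H. apply differentiable_continuity_pt. now exists lx, ly.
Qed.

Lemma is_derive_comp_2d F (f g : R -> R) t lx ly df dg :
  differentiable_pt_lim F (f t) (g t) lx ly ->
  is_derive f t df -> is_derive g t dg ->
  is_derive (fun s => F (f s) (g s)) t (lx * df + ly * dg).
Proof.
  intros HF Hf Hg. apply is_derive_Reals.
  apply derivable_pt_lim_comp_2d; trivial; now apply is_derive_Reals.
Qed.

Lemma is_derive_slice1 F x y lx ly :
  differentiable_pt_lim F x y lx ly -> is_derive (fun t => F t y) x lx.
Proof.
  intros HF. replace lx with (lx * 1 + ly * 0) by ring.
  apply (is_derive_comp_2d F (fun t => t) (fun _ => y) x lx ly 1 0); trivial.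
  - exact (is_derive_id (x : R_AbsRing)).
  - exact (is_derive_const (y : R_NormedModule) x).
Qed.

Lemma is_derive_slice2 F x y lx ly :
  differentiable_pt_lim F x y lx ly -> is_derive (fun t => F x t) y ly.
Proof.
  intros HF. replace ly with (lx * 0 + ly * 1) by ring.
  apply (is_derive_comp_2d F (fun _ => x) (fun t => t) y lx ly 0 1); trivial.
  - exact (is_derive_const (x : R_NormedModule) y).
  - exact (is_derive_id (y : R_AbsRing)).
Qed.

Definition smooth2 (F : R -> R -> R) : Prop :=
  smooth (fun p => F (coord c1 p) (coord c2 p)).

Lemma smooth_partial i f : smooth f -> smooth (partial i f).
Proof.
  intros Hf I.
  assert (E : partials I (partial i f) = partials (I ++ i :: nil) f).
  { induction I as [|j I IH]; [reflexivity|]. simpl. now rewrite IH. }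
  rewrite E. apply Hf.
Qed.

Lemma smooth2_d1 F : smooth2 F -> smooth2 (fun x y => Derive (fun t => F t y) x).
Proof. exact (smooth_partial c1 _). Qed.

Lemma smooth2_d2 F : smooth2 F -> smooth2 (fun x y => Derive (fun t => F x t) y).
Proof. exact (smooth_partial c2 _). Qed.

Lemma smooth2_continuity F x y : smooth2 F -> continuity_2d_pt F x y.
Proof.
  intros HF eps. destruct (HF nil) as [Hc _].
  destruct (proj1 (filterlim_locally _ _) (Hc (x, y, 0)) eps) as [d Hd].
  exists d. intros a b Ha Hb.
  apply (Hd (a, b, 0)). repeat split; trivial. apply ball_center.
Qed.

Lemma smooth2_ex_derive1 F x y : smooth2 F -> ex_derive (fun t => F t y) x.
Proof. intros HF. exact (proj2 (HF nil) c1 (x, y, 0)). Qed.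

Lemma smooth2_ex_derive2 F x y : smooth2 F -> ex_derive (fun t => F x t) y.
Proof. intros HF. exact (proj2 (HF nil) c2 (x, y, 0)). Qed.

(** Both partials exist and one of them is jointly continuous, which is enough for Fréchet
    differentiability. *)
Lemma smooth2_differentiable F x y : smooth2 F ->
  differentiable_pt_lim F x y (Derive (fun t => F t y) x) (Derive (fun t => F x t) y).
Proof.
  intros HF. apply filterdiff_differentiable_pt_lim.
  apply (is_derive_filterdiff F x y (fun a b => Derive (fun t => F t b) a)).
  - apply filter_forall. intros [a b].
    apply Derive_correct, smooth2_ex_derive1, HF.
  - apply Derive_correct, smooth2_ex_derive2, HF.
  - apply (continuity_2d_pt_filterlim (fun a b => Derive (fun t => F t b) a)).
    apply smooth2_continuity, smooth2_d1, HF.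
Qed.

Lemma smooth2_C2 F : smooth2 F ->
  exists F1 F2 F11 F12 F22, C2 F F1 F2 F11 F12 F22.
Proof.
  intros HF.
  pose proof (smooth2_d1 F HF) as H1. pose proof (smooth2_d2 F HF) as H2.
  exists (fun x y => Derive (fun t => F t y) x),
    (fun x y => Derive (fun t => F x t) y),
    (fun x y => Derive (fun s => Derive (fun t => F t y) s) x),
    (fun x y => Derive (fun s => Derive (fun t => F s t) y) x),
    (fun x y => Derive (fun s => Derive (fun t => F x t) s) y).
  (* Equality of the mixed partials lets one function [F12] serve in the differentials of both [F1]
     and [F2]. *)
  assert (S : forall x y, Derive (fun s => Derive (fun t => F s t) y) x =
                          Derive (fun s => Derive (fun t => F t s) x) y).
  { intros x y. apply Schwarz.
    - exists (mkposreal 1 Rlt_0_1). intros a b _ _. repeat split.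
      + now apply smooth2_ex_derive1.
      + now apply smooth2_ex_derive2.
      + exact (smooth2_ex_derive1 _ a b H2).
      + exact (smooth2_ex_derive2 _ a b H1).
    - exact (smooth2_continuity _ x y (smooth2_d1 _ H2)).
    - exact (smooth2_continuity _ x y (smooth2_d2 _ H1)). }
  split; intros x y.
  - now apply smooth2_differentiable.
  - rewrite S. exact (smooth2_differentiable _ x y H1).
  - exact (smooth2_differentiable _ x y H2).
  - exact (smooth2_continuity _ x y (smooth2_d1 _ H1)).
  - exact (smooth2_continuity _ x y (smooth2_d1 _ H2)).
  - exact (smooth2_continuity _ x y (smooth2_d2 _ H2)).
Qed.

(** * Curvature in cylindrical coordinates *)

Definition diag_form (i j : ix) (a b : R) : R :=
  match i, j with
  | c1, c1 | c2, c2 => a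
  | c3, c3 => b
  | _, _ => 0
  end.

(* [U] and [Al] extend [u] and [alpha] smoothly across the axis, the other functions are their
   partial derivatives, and [prof_cyl] encodes [A = B = 0]. *)
Record profile (g : axisym_metric)
    (U U1 U2 U11 U12 U22 Al A1 A2 A11 A12 A22 : R -> R -> R) : Prop := {
  prof_U : C2 U U1 U2 U11 U12 U22;
  prof_A : C2 Al A1 A2 A11 A12 A22;
  prof_u : forall x z, 0 <= x -> u g x z = U x z;
  prof_alpha : forall x z, 0 <= x -> alpha g x z = Al x z;
  prof_cyl : forall i j x z, 0 <= x ->
    cyl g i j x z =
      diag_form i j (exp (2 * Al x z - 2 * U x z)) (x ^ 2 * exp (- 2 * U x z))
}.

Lemma profile_exists g :
  (forall rho z : R, 0 <= rho -> A g rho z = 0 /\ B g rho z = 0) ->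
  exists U U1 U2 U11 U12 U22 Al A1 A2 A11 A12 A22,
    profile g U U1 U2 U11 U12 U22 Al A1 A2 A11 A12 A22.
Proof.
  intros HAB.
  destruct (u_smooth g) as [U [HU EU]]. destruct (alpha_smooth g) as [Al [HA EA]].
  destruct (smooth2_C2 U HU) as (U1 & U2 & U11 & U12 & U22 & CU).
  destruct (smooth2_C2 Al HA) as (A1 & A2 & A11 & A12 & A22 & CA).
  exists U, U1, U2, U11, U12, U22, Al, A1, A2, A11, A12, A22. split; trivial.
  - intros x z Hx. now rewrite EU.
  - intros x z Hx. now rewrite EA.
  - intros i j x z Hx. unfold cyl, cyl_metric.
    destruct (HAB x z Hx) as [-> ->]. rewrite <- EU, <- EA by trivial.
    destruct i, j; cbn; ring.
Qed.

Lemma partial_ext_pos i f f' p :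
  (forall q, 0 < coord c1 q -> f q = f' q) -> 0 < coord c1 p ->
  partial i f p = partial i f' p.
Proof.
  intros E Hp. apply Derive_ext_loc.
  destruct i.
  - exists (mkposreal _ Hp). intros t Ht. apply E. cbn.
    apply Rabs_def2 in Ht. unfold minus, plus, opp in Ht. cbn in *. lra.
  - exists (mkposreal 1 Rlt_0_1). intros t _. now apply E.
  - exists (mkposreal 1 Rlt_0_1). intros t _. now apply E.
Qed.

Lemma partial_c1 F p l : is_derive (fun t => F t (coord c2 p)) (coord c1 p) l ->
  partial c1 (fun q => F (coord c1 q) (coord c2 q)) p = l.
Proof. apply is_derive_unique. Qed.

Lemma partial_c2 F p l : is_derive (fun t => F (coord c1 p) t) (coord c2 p) l ->
  partial c2 (fun q => F (coord c1 q) (coord c2 q)) p = l.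
Proof. apply is_derive_unique. Qed.

Lemma partial_c3 (F : R -> R -> R) p :
  partial c3 (fun q => F (coord c1 q) (coord c2 q)) p = 0.
Proof. exact (Derive_const (F (coord c1 p) (coord c2 p)) _). Qed.

(** Settles the existence conditions left by [auto_derive] for slices of functions whose
    differentials are in context; [slice_value] then rewrites the [Derive] terms to the known
    partials. *)
Ltac slice :=
  repeat match goal with
  | |- _ /\ _ => split
  | |- True => exact I
  | H : forall x y, differentiable_pt_lim ?F x y _ _ |- ex_derive (fun t => ?F t ?y) ?x =>
      eexists; exact (is_derive_slice1 _ _ _ _ _ (H x y))
  | H : forall x y, differentiable_pt_lim ?F x y _ _ |- ex_derive (fun t => ?F ?x t) ?y =>
      eexists; exact (is_derive_slice2 _ _ _ _ _ (H x y))
  end.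

Ltac slice_value :=
  repeat match goal with
  | H : forall x y, differentiable_pt_lim ?F x y _ _ |- context [Derive (fun t => ?F t ?y) ?x] =>
      rewrite (proj1 (differentiable_pt_lim_unique _ _ _ _ _ (H x y)))
  | H : forall x y, differentiable_pt_lim ?F x y _ _ |- context [Derive (fun t => ?F ?x t) ?y] =>
      rewrite (proj2 (differentiable_pt_lim_unique _ _ _ _ _ (H x y)))
  end.

Ltac C2_facts :=
  repeat match goal with
  | H : C2 _ _ _ _ _ _ |- _ =>
      pose proof (C2_d _ _ _ _ _ _ H); pose proof (C2_d1 _ _ _ _ _ _ H);
      pose proof (C2_d2 _ _ _ _ _ _ H); clear H
  end.

(** The Levi-Civita connection of [e^(2 alpha - 2 u) (drho^2 + dz^2) + rho^2 e^(-2 u) dphi^2]. The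
    factor [e^(-2 alpha)] is the quotient of the two exponentials. *)
Definition diag_christoffel (Al U1 U2 A1 A2 : R -> R -> R) (k i j : ix) (x z : R) : R :=
  match k, i, j with
  | c1, c1, c1 => A1 x z - U1 x z
  | c1, c2, c2 => - (A1 x z - U1 x z)
  | c1, c3, c3 => - (x - x ^ 2 * U1 x z) * exp (- 2 * Al x z)
  | c1, c1, c2 | c1, c2, c1 => A2 x z - U2 x z
  | c2, c1, c1 => - (A2 x z - U2 x z)
  | c2, c2, c2 => A2 x z - U2 x z
  | c2, c3, c3 => x ^ 2 * U2 x z * exp (- 2 * Al x z)
  | c2, c1, c2 | c2, c2, c1 => A1 x z - U1 x z
  | c3, c1, c3 | c3, c3, c1 => / x - U1 x z
  | c3, c2, c3 | c3, c3, c2 => - U2 x z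
  | _, _, _ => 0
  end.

Lemma profile_ginv g U U1 U2 U11 U12 U22 Al A1 A2 A11 A12 A22
    (H : profile g U U1 U2 U11 U12 U22 Al A1 A2 A11 A12 A22) i j p :
  0 < coord c1 p ->
  ginv (cyl_tensor g) i j p =
    let x := coord c1 p in let z := coord c2 p in
    diag_form i j (/ exp (2 * Al x z - 2 * U x z)) (/ (x ^ 2 * exp (- 2 * U x z))).
Proof.
  intros Hp. unfold ginv, det3, cofactor3, sum3, cyl_tensor.
  rewrite !(prof_cyl _ _ _ _ _ _ _ _ _ _ _ _ _ H) by lra.
  cbv zeta. set (x := coord c1 p) in *.
  pose proof (exp_pos (2 * Al x (coord c2 p) - 2 * U x (coord c2 p))).
  pose proof (exp_pos (- 2 * U x (coord c2 p))).
  destruct i, j; cbn -[pow]; field; repeat split; apply Rgt_not_eq; assumption.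
Qed.

Lemma profile_christoffel g U U1 U2 U11 U12 U22 Al A1 A2 A11 A12 A22
    (H : profile g U U1 U2 U11 U12 U22 Al A1 A2 A11 A12 A22) k i j p :
  0 < coord c1 p ->
  christoffel (cyl_tensor g) k i j p =
    diag_christoffel Al U1 U2 A1 A2 k i j (coord c1 p) (coord c2 p).
Proof.
  intros Hp.
  pose (dg := fun (l : ix) (i j : ix) (x z : R) => match l with
    | c1 => diag_form i j
        (exp (2 * Al x z - 2 * U x z) * (2 * A1 x z - 2 * U1 x z))
        (exp (- 2 * U x z) * (2 * x - 2 * x ^ 2 * U1 x z))
    | c2 => diag_form i j
        (exp (2 * Al x z - 2 * U x z) * (2 * A2 x z - 2 * U2 x z))
        (exp (- 2 * U x z) * (- 2 * x ^ 2 * U2 x z))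
    | c3 => 0 end).
  assert (D : forall l i j, partial l (cyl_tensor g i j) p = dg l i j (coord c1 p) (coord c2 p)).
  { intros l a b.
    pose (F := fun x z => diag_form a b (exp (2 * Al x z - 2 * U x z))
       (x ^ 2 * exp (- 2 * U x z))).
    rewrite (partial_ext_pos l _ (fun q => F (coord c1 q) (coord c2 q))); trivial.
    2:{ intros q Hq. unfold cyl_tensor.
        rewrite (prof_cyl _ _ _ _ _ _ _ _ _ _ _ _ _ H) by lra. reflexivity. }
    destruct H as [CU CA _ _ _]. C2_facts.
    destruct l.
    - apply (partial_c1 F). unfold F. generalize (coord c1 p), (coord c2 p). intros x z.
      destruct a, b; cbn -[pow]; auto_derive; slice; slice_value; unfold Rminus; ring.
    - apply (partial_c2 F). unfold F. generalize (coord c1 p), (coord c2 p). intros x z.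
      destruct a, b; cbn -[pow]; auto_derive; slice; slice_value; unfold Rminus; ring.
    - apply (partial_c3 F). }
  unfold christoffel, sum3. rewrite !D.
  rewrite !(profile_ginv _ _ _ _ _ _ _ _ _ _ _ _ _ H) by trivial.
  unfold dg. cbv zeta. set (x := coord c1 p) in *. set (z := coord c2 p).
  (* After this rewriting both sides are rational in the two exponentials of the metric, within
     reach of [field]. *)
  assert (E : exp (- 2 * Al x z) = exp (- 2 * U x z) / exp (2 * Al x z - 2 * U x z)).
  { unfold Rdiv. rewrite <- exp_Ropp, <- exp_plus. f_equal. ring. }
  unfold diag_christoffel. rewrite E.
  pose proof (exp_pos (2 * Al x z - 2 * U x z)).
  pose proof (exp_pos (- 2 * U x z)).
  destruct k, i, j; cbn -[pow]; field; repeat split; apply Rgt_not_eq; assumption.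
Qed.

(** The conformal factor splits off a bracket [N - 2 |Du|^2] in which [N] is linear in [u] and
    [alpha], and [rho N] is the divergence of [4 rho Du - 2 rho Dalpha + 2 alpha e_rho], with
    [e_rho] the unit vector along [rho]. *)
Lemma profile_scalar g U U1 U2 U11 U12 U22 Al A1 A2 A11 A12 A22
    (H : profile g U U1 U2 U11 U12 U22 Al A1 A2 A11 A12 A22) p :
  0 < coord c1 p ->
  let x := coord c1 p in let z := coord c2 p in
  scalar_curvature (cyl_tensor g) p =
    exp (2 * U x z - 2 * Al x z) *
    (4 * (U11 x z + U22 x z) + 4 * U1 x z / x - 2 * (A11 x z + A22 x z)
     - 2 * (U1 x z ^ 2 + U2 x z ^ 2)).
Proof.
  intros Hp x z.
  pose (dG := fun (m k i j : ix) (x z : R) => match m with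
    | c1 => match k, i, j with
      | c1, c1, c1 => A11 x z - U11 x z
      | c1, c2, c2 => - (A11 x z - U11 x z)
      | c1, c3, c3 => (- (1 - 2 * x * U1 x z - x ^ 2 * U11 x z)
                       + 2 * A1 x z * (x - x ^ 2 * U1 x z)) * exp (- 2 * Al x z)
      | c1, c1, c2 | c1, c2, c1 => A12 x z - U12 x z
      | c2, c1, c1 => - (A12 x z - U12 x z)
      | c2, c2, c2 => A12 x z - U12 x z
      | c2, c3, c3 => (2 * x * U2 x z + x ^ 2 * U12 x z - 2 * A1 x z * x ^ 2 * U2 x z)
                      * exp (- 2 * Al x z)
      | c2, c1, c2 | c2, c2, c1 => A11 x z - U11 x z
      | c3, c1, c3 | c3, c3, c1 => - / x ^ 2 - U11 x z
      | c3, c2, c3 | c3, c3, c2 => - U12 x z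
      | _, _, _ => 0
      end
    | c2 => match k, i, j with
      | c1, c1, c1 => A12 x z - U12 x z
      | c1, c2, c2 => - (A12 x z - U12 x z)
      | c1, c3, c3 => (x ^ 2 * U12 x z + 2 * A2 x z * (x - x ^ 2 * U1 x z)) * exp (- 2 * Al x z)
      | c1, c1, c2 | c1, c2, c1 => A22 x z - U22 x z
      | c2, c1, c1 => - (A22 x z - U22 x z)
      | c2, c2, c2 => A22 x z - U22 x z
      | c2, c3, c3 => (x ^ 2 * U22 x z - 2 * A2 x z * x ^ 2 * U2 x z) * exp (- 2 * Al x z)
      | c2, c1, c2 | c2, c2, c1 => A12 x z - U12 x z
      | c3, c1, c3 | c3, c3, c1 => - U12 x z
      | c3, c2, c3 | c3, c3, c2 => - U22 x z
      | _, _, _ => 0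
      end
    | c3 => 0 end).
  assert (D : forall m k i j, partial m (christoffel (cyl_tensor g) k i j) p = dG m k i j x z).
  { intros m k i j.
    pose (F := diag_christoffel Al U1 U2 A1 A2 k i j).
    rewrite (partial_ext_pos m _ (fun q => F (coord c1 q) (coord c2 q))); trivial.
    2:{ intros q Hq. exact (profile_christoffel _ _ _ _ _ _ _ _ _ _ _ _ _ H k i j q Hq). }
    destruct H as [CU CA _ _ _]. C2_facts.
    assert (Hx : coord c1 p <> 0) by (apply Rgt_not_eq; exact Hp).
    destruct m.
    - apply (partial_c1 F). unfold F, x, z. revert Hx.
      generalize (coord c1 p), (coord c2 p). intros x0 z0 Hx.
      destruct k, i, j; cbn -[pow]; auto_derive; slice; trivial; slice_value; unfold Rminus; field; trivial.
    - apply (partial_c2 F). unfold F, x, z. revert Hx.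
      generalize (coord c1 p), (coord c2 p). intros x0 z0 Hx.
      destruct k, i, j; cbn -[pow]; auto_derive; slice; trivial; slice_value; unfold Rminus; field; trivial.
    - apply (partial_c3 F). }
  unfold scalar_curvature, ricci, sum3. rewrite !D.
  rewrite !(profile_christoffel _ _ _ _ _ _ _ _ _ _ _ _ _ H) by trivial.
  rewrite !(profile_ginv _ _ _ _ _ _ _ _ _ _ _ _ _ H) by trivial.
  change (coord c1 p) with x. change (coord c2 p) with z. cbv zeta.
  assert (Hx : 0 < x) by exact Hp.
  replace (exp (2 * U x z - 2 * Al x z)) with (/ exp (2 * Al x z - 2 * U x z))
    by (rewrite <- exp_Ropp; f_equal; ring).
  assert (E : exp (- 2 * Al x z) = exp (- 2 * U x z) / exp (2 * Al x z - 2 * U x z)).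
  { unfold Rdiv. rewrite <- exp_Ropp, <- exp_plus. f_equal. ring. }
  pose proof (exp_pos (2 * Al x z - 2 * U x z)).
  pose proof (exp_pos (- 2 * U x z)).
  unfold dG, diag_christoffel, diag_form. rewrite E.
  field; repeat split; apply Rgt_not_eq; assumption.
Qed.

(** Here [|eta| = rho e^(-u)] and [|D rho| = e^(u - alpha)], so the monotone quantity is
    [e^(alpha - 2 u)], whose derivative has the sign of [alpha_rho - 2 u_rho]. *)
Lemma profile_monotone g U U1 U2 U11 U12 U22 Al A1 A2 A11 A12 A22
    (H : profile g U U1 U2 U11 U12 U22 Al A1 A2 A11 A12 A22) x z :
  0 < x ->
  partial c1 (fun q => / coord c1 q * (vector_norm (cyl_tensor g) killing_field q
                      / gradient_norm (cyl_tensor g) (coord c1) q)) (x, z, 0) <= 0 ->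
  A1 x z - 2 * U1 x z <= 0.
Proof.
  intros Hx.
  pose (F := fun x z => exp (Al x z - 2 * U x z)).
  rewrite (partial_ext_pos c1 _ (fun q => F (coord c1 q) (coord c2 q))); trivial.
  2:{ intros q Hq.
      assert (D : forall i, partial i (coord c1) q = kron i c1).
      { intros []; [exact (Derive_id _) | exact (Derive_const _ _) ..]. }
      unfold vector_norm, gradient_norm, sum3, killing_field. rewrite !D.
      rewrite !(profile_ginv _ _ _ _ _ _ _ _ _ _ _ _ _ H) by trivial.
      unfold cyl_tensor. rewrite !(prof_cyl _ _ _ _ _ _ _ _ _ _ _ _ _ H) by lra.
      cbn -[pow coord Rdiv]. cbv zeta. unfold F.
      set (a := coord c1 q) in *. set (b := coord c2 q).
      match goal with |- _ * (sqrt ?s / sqrt ?t) = _ =>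
        replace s with ((a * exp (- U a b)) ^ 2);
        [replace t with ((exp (U a b - Al a b)) ^ 2)|] end.
      - rewrite !sqrt_pow2.
        + replace (exp (Al a b - 2 * U a b)) with (exp (- U a b) / exp (U a b - Al a b)).
          * field. split; apply Rgt_not_eq; [apply exp_pos | trivial].
          * unfold Rdiv. rewrite <- exp_Ropp, <- exp_plus. f_equal. ring.
        + left. apply exp_pos.
        + apply Rmult_le_pos; [lra | left; apply exp_pos].
      - simpl. rewrite <- exp_Ropp.
        replace (- (2 * Al a b - 2 * U a b)) with ((U a b - Al a b) + (U a b - Al a b)) by ring.
        rewrite exp_plus. ring.
      - replace (- 2 * U a b) with (- U a b + - U a b) by ring.
        rewrite exp_plus. ring. }
  destruct H as [CU CA _ _ _]. C2_facts.
  rewrite (partial_c1 F (x, z, 0) (exp (Al x z - 2 * U x z) * (A1 x z - 2 * U1 x z))).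
  - intros Hle. pose proof (exp_pos (Al x z - 2 * U x z)). nra.
  - unfold F. cbn -[pow]. auto_derive; slice. slice_value. unfold Rminus. ring.
Qed.

(** * Cartesian components and the ADM flux *)

Lemma rho_of_polar t c s z : 0 < t -> c ^ 2 + s ^ 2 = 1 -> rho_of (t * c, t * s, z) = t.
Proof.
  intros Ht Hcs. unfold rho_of. cbn -[pow].
  replace ((t * c) ^ 2 + (t * s) ^ 2) with (t ^ 2 * (c ^ 2 + s ^ 2)) by ring.
  rewrite Hcs, Rmult_1_r. apply sqrt_pow2. lra.
Qed.

Lemma profile_cart g U U1 U2 U11 U12 U22 Al A1 A2 A11 A12 A22
    (H : profile g U U1 U2 U11 U12 U22 Al A1 A2 A11 A12 A22) a b p :
  0 < rho_of p ->
  cart g a b p =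
    exp (2 * Al (rho_of p) (z_of p) - 2 * U (rho_of p) (z_of p)) *
      (cyl_jac c1 a p * cyl_jac c1 b p + cyl_jac c2 a p * cyl_jac c2 b p) +
    rho_of p ^ 2 * exp (- 2 * U (rho_of p) (z_of p)) * (cyl_jac c3 a p * cyl_jac c3 b p).
Proof.
  intros Hp. rewrite cart_cyl by trivial. fold (cyl g).
  unfold sum3. rewrite !(prof_cyl _ _ _ _ _ _ _ _ _ _ _ _ _ H) by lra.
  unfold diag_form. ring.
Qed.

(** Carries a formula known off the axis over to the axis, by uniqueness of one-sided limits. *)
Lemma ex_derive_eq_right (f g : R -> R) x :
  ex_derive f x -> ex_derive g x -> (forall t, x < t -> f t = g t) -> f x = g x.
Proof.
  intros Hf Hg E.
  apply (ex_derive_continuous (V := R_NormedModule)) in Hf, Hg.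
  apply (filterlim_locally_unique (F := at_right x) f).
  - eapply filterlim_filter_le_1; [apply filter_le_within | exact Hf].
  - apply filterlim_within_ext with g.
    + intros t Ht. symmetry. now apply E.
    + eapply filterlim_filter_le_1; [apply filter_le_within | exact Hg].
Qed.

(* The Cartesian component [g_xx] is [e^(2 alpha - 2 u)] along the [x]-axis direction
   and [e^(-2 u)] along the [y]-axis direction; both must agree on the axis. *)
Lemma profile_axis g U U1 U2 U11 U12 U22 Al A1 A2 A11 A12 A22
    (H : profile g U U1 U2 U11 U12 U22 Al A1 A2 A11 A12 A22) z : Al 0 z = 0.
Proof.
  pose proof (proj1 (cart_riemannian g) c1 c1 nil) as [_ S]. cbn in S.
  assert (CU : forall F lx ly, differentiable_pt_lim F 0 z lx ly ->
    ex_derive (fun t => F t z) 0).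
  { intros F lx ly HF. exists lx. exact (is_derive_slice1 _ _ _ _ _ HF). }
  pose proof (CU _ _ _ (C2_d _ _ _ _ _ _ (prof_U _ _ _ _ _ _ _ _ _ _ _ _ _ H) 0 z)) as DU.
  pose proof (CU _ _ _ (C2_d _ _ _ _ _ _ (prof_A _ _ _ _ _ _ _ _ _ _ _ _ _ H) 0 z)) as DA.
  assert (E1 : cart g c1 c1 (0, 0, z) = exp (2 * Al 0 z - 2 * U 0 z)).
  { apply (ex_derive_eq_right (fun t => cart g c1 c1 (t, 0, z))
      (fun t => exp (2 * Al t z - 2 * U t z)) 0).
    - exact (S c1 (0, 0, z)).
    - now auto_derive.
    - intros t Ht. assert (Hr : rho_of (t, 0, z) = t).
      { transitivity (rho_of (t * 1, t * 0, z)); [repeat f_equal; ring|].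
        apply rho_of_polar; [trivial | ring]. }
      rewrite (profile_cart _ _ _ _ _ _ _ _ _ _ _ _ _ H), Hr by lra.
      cbn -[pow]. rewrite Hr. field. lra. }
  assert (E2 : cart g c1 c1 (0, 0, z) = exp (- 2 * U 0 z)).
  { apply (ex_derive_eq_right (fun t => cart g c1 c1 (0, t, z))
      (fun t => exp (- 2 * U t z)) 0).
    - exact (S c2 (0, 0, z)).
    - now auto_derive.
    - intros t Ht. assert (Hr : rho_of (0, t, z) = t).
      { transitivity (rho_of (t * 0, t * 1, z)); [repeat f_equal; ring|].
        apply rho_of_polar; [trivial | ring]. }
      rewrite (profile_cart _ _ _ _ _ _ _ _ _ _ _ _ _ H), Hr by lra.
      cbn -[pow]. rewrite Hr. field. lra. }
  rewrite E1 in E2. apply exp_inv in E2. lra.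
Qed.

Lemma rho_of_pos_locally k p : 0 < rho_of p ->
  locally (coord k p) (fun t => 0 < rho_of (set_coord k p t)).
Proof.
  intros Hp.
  assert (C : continuous (fun t => rho_of (set_coord k p t)) (coord k p)).
  { unfold rho_of. apply (continuous_comp _ sqrt).
    - apply (ex_derive_continuous (V := R_NormedModule)). destruct k; cbn -[pow]; auto_derive; trivial.
    - apply continuity_pt_filterlim, continuity_pt_sqrt.
      destruct k; cbn -[pow]; nra. }
  assert (E : set_coord k p (coord k p) = p).
  { destruct p as [[x y] z]. now destruct k. }
  apply (C (fun r => 0 < r)). rewrite E.
  exists (mkposreal _ Hp). intros y Hy. unfold ball in Hy. cbn in Hy.
  unfold AbsRing_ball, abs, minus, plus, opp in Hy. cbn in Hy.
  apply Rabs_def2 in Hy. lra.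
Qed.

Lemma is_derive_rho_of k t c s z : 0 < t -> c ^ 2 + s ^ 2 = 1 ->
  let p := (t * c, t * s, z) in
  is_derive (fun v => rho_of (set_coord k p v)) (coord k p)
    match k with c1 => c | c2 => s | c3 => 0 end.
Proof.
  intros Ht Hcs p.
  pose proof (rho_of_polar t c s z Ht Hcs) as Hr. unfold rho_of in Hr.
  assert (0 < (t * c) ^ 2 + (t * s) ^ 2).
  { replace ((t * c) ^ 2 + (t * s) ^ 2) with (t ^ 2 * (c ^ 2 + s ^ 2)) by ring. rewrite Hcs. nra. }
  unfold rho_of. destruct k; cbn -[pow] in *; auto_derive; trivial.
  - cbn -[pow]. simpl in Hr |- *. rewrite Hr. field. lra.
  - cbn -[pow]. simpl in Hr |- *. rewrite Hr. field. lra.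
Qed.

Lemma is_derive_coord k a p :
  is_derive (fun v => coord a (set_coord k p v)) (coord k p) (kron a k).
Proof.
  destruct k, a; first [exact (is_derive_id _) | exact (is_derive_const _ _)].
Qed.

(** Every nonconstant entry of [cyl_jac] is a signed coordinate over [rho] or [rho^2], the cases
    [n = 0] and [n = 1]. *)
Lemma is_derive_quotient_pow (f r : R -> R) x df dr n :
  is_derive f x df -> is_derive r x dr -> r x <> 0 ->
  is_derive (fun v => f v / r v ^ S n) x ((df * r x - INR (S n) * f x * dr) / r x ^ S (S n)).
Proof.
  intros Hf Hr H0. auto_derive.
  - repeat split; [now exists df | now exists dr | now apply (pow_nonzero _ (S n))].
  - rewrite (is_derive_unique _ _ _ Hf : Derive (fun v => f v) x = df).
    rewrite (is_derive_unique _ _ _ Hr : Derive (fun v => r v) x = dr).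
    change (match n with 0%nat => 1 | S _ => INR n + 1 end) with (INR (S n)).
    simpl. field. split; [now apply pow_nonzero | trivial].
Qed.

Lemma is_derive_cyl_jac k m a t c s z : 0 < t -> c ^ 2 + s ^ 2 = 1 ->
  let p := (t * c, t * s, z) in
  is_derive (fun v => cyl_jac m a (set_coord k p v)) (coord k p)
    match m, a, k with
    | c1, c1, c1 => s ^ 2 / t
    | c1, c1, c2 | c1, c2, c1 => - c * s / t
    | c1, c2, c2 => c ^ 2 / t
    | c3, c1, c1 => 2 * c * s / t ^ 2
    | c3, c1, c2 | c3, c2, c1 => (s ^ 2 - c ^ 2) / t ^ 2
    | c3, c2, c2 => - 2 * c * s / t ^ 2
    | _, _, _ => 0
    end.
Proof.
  intros Ht Hcs p.
  pose proof (is_derive_rho_of k t c s z Ht Hcs) as D. cbv zeta in D. fold p in D.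
  assert (E : rho_of (set_coord k p (coord k p)) = t).
  { rewrite <- (rho_of_polar t c s z Ht Hcs). now destruct k. }
  assert (s2 : s ^ 2 = 1 - c ^ 2) by lra.
  assert (H0 : rho_of (set_coord k p (coord k p)) <> 0) by lra.
  pose proof (is_derive_coord k c1 p) as D1. pose proof (is_derive_coord k c2 p) as D2.
  pose proof (is_derive_opp _ _ _ D2) as D2'.
  pose proof (is_derive_quotient_pow _ _ _ _ _ 0 D1 D H0) as Q1.
  pose proof (is_derive_quotient_pow _ _ _ _ _ 0 D2 D H0) as Q2.
  pose proof (is_derive_quotient_pow _ _ _ _ _ 1 D2' D H0) as Q3.
  pose proof (is_derive_quotient_pow _ _ _ _ _ 1 D1 D H0) as Q4.
  cbv beta in Q1, Q2, Q3, Q4. rewrite E in Q1, Q2, Q3, Q4. clear D D1 D2 D2' E H0.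
  assert (P1 : forall x r, x / r = x / r ^ 1) by (intros; now rewrite pow_1).
  destruct m, a; try exact (is_derive_const _ _).
  - apply (is_derive_ext (fun v => coord c1 (set_coord k p v) / rho_of (set_coord k p v) ^ 1)).
    { intros v. symmetry. apply P1. }
    evar_last; [exact Q1|]. destruct k; cbn; field [s2]; lra.
  - apply (is_derive_ext (fun v => coord c2 (set_coord k p v) / rho_of (set_coord k p v) ^ 1)).
    { intros v. symmetry. apply P1. }
    evar_last; [exact Q2|]. destruct k; cbn; field [s2]; lra.
  - evar_last; [exact Q3|]. destruct k; cbn; field [s2]; lra.
  - evar_last; [exact Q4|]. destruct k; cbn; field [s2]; lra.
Qed.

Lemma is_derive_metric_product (al uu r a1 b1 a2 b2 a3 b3 : R -> R) x
    dal duu dr da1 db1 da2 db2 da3 db3 :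
  is_derive al x dal -> is_derive uu x duu -> is_derive r x dr ->
  is_derive a1 x da1 -> is_derive b1 x db1 -> is_derive a2 x da2 -> is_derive b2 x db2 ->
  is_derive a3 x da3 -> is_derive b3 x db3 ->
  is_derive (fun v => exp (2 * al v - 2 * uu v) * (a1 v * b1 v + a2 v * b2 v)
      + r v ^ 2 * exp (- 2 * uu v) * (a3 v * b3 v)) x
    (exp (2 * al x - 2 * uu x) * ((2 * dal - 2 * duu) * (a1 x * b1 x + a2 x * b2 x)
        + (da1 * b1 x + a1 x * db1 + da2 * b2 x + a2 x * db2))
     + exp (- 2 * uu x) * ((2 * r x * dr - 2 * r x ^ 2 * duu) * (a3 x * b3 x)
        + r x ^ 2 * (da3 * b3 x + a3 x * db3))).
Proof.
  intros. auto_derive.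
  - repeat split; eexists; eassumption.
  - repeat match goal with
    | H : is_derive ?f x _ |- context [Derive ?g x] =>
        rewrite (is_derive_unique _ _ _ H : Derive g x = _)
    end.
    unfold Rminus. ring.
Qed.

(** The angle enters only through [c] and [s] with [c^2 + s^2 = 1], which keeps the flux computation
    algebraic. [X] holds the Jacobian entries at the point and [Y] their derivatives in direction
    [k]. *)
Lemma profile_cart_partial g U U1 U2 U11 U12 U22 Al A1 A2 A11 A12 A22
    (H : profile g U U1 U2 U11 U12 U22 Al A1 A2 A11 A12 A22) k a b t c s z :
  0 < t -> c ^ 2 + s ^ 2 = 1 ->
  let P := exp (2 * Al t z - 2 * U t z) in
  let Q := exp (- 2 * U t z) in
  let dr := match k with c1 => c | c2 => s | c3 => 0 end in
  let dz := kron k c3 in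
  let X m a := match m, a with
    | c1, c1 => c | c1, c2 => s | c2, c3 => 1
    | c3, c1 => - s / t | c3, c2 => c / t | _, _ => 0 end in
  let Y m a := match m, a, k with
    | c1, c1, c1 => s ^ 2 / t
    | c1, c1, c2 | c1, c2, c1 => - c * s / t
    | c1, c2, c2 => c ^ 2 / t
    | c3, c1, c1 => 2 * c * s / t ^ 2
    | c3, c1, c2 | c3, c2, c1 => (s ^ 2 - c ^ 2) / t ^ 2
    | c3, c2, c2 => - 2 * c * s / t ^ 2
    | _, _, _ => 0 end in
  partial k (cart g a b) (t * c, t * s, z) =
    P * ((2 * (A1 t z * dr + A2 t z * dz) - 2 * (U1 t z * dr + U2 t z * dz))
           * (X c1 a * X c1 b + X c2 a * X c2 b)
         + (Y c1 a * X c1 b + X c1 a * Y c1 b + Y c2 a * X c2 b + X c2 a * Y c2 b))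
    + Q * ((2 * t * dr - 2 * t ^ 2 * (U1 t z * dr + U2 t z * dz)) * (X c3 a * X c3 b)
           + t ^ 2 * (Y c3 a * X c3 b + X c3 a * Y c3 b)).
Proof.
  intros Ht Hcs P Q dr dz X Y. set (p := (t * c, t * s, z)).
  pose proof (rho_of_polar t c s z Ht Hcs) as Hr. fold p in Hr.
  assert (Ep : set_coord k p (coord k p) = p) by now destruct k.
  assert (HX : forall m a, cyl_jac m a p = X m a).
  { intros m n. destruct m, n; unfold cyl_jac, X; rewrite ?Hr; cbn; trivial; field; lra. }
  assert (Dr : is_derive (fun v => rho_of (set_coord k p v)) (coord k p) dr).
  { exact (is_derive_rho_of k t c s z Ht Hcs). }
  assert (Dz : is_derive (fun v => z_of (set_coord k p v)) (coord k p) dz).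
  { unfold dz. replace (kron k c3) with (kron c3 k) by now destruct k.
    exact (is_derive_coord k c3 p). }
  assert (DX : forall m a, is_derive (fun v => cyl_jac m a (set_coord k p v)) (coord k p) (Y m a)).
  { intros m n. exact (is_derive_cyl_jac k m n t c s z Ht Hcs). }
  assert (DF : forall F lx ly, differentiable_pt_lim F t z lx ly ->
    is_derive (fun v => F (rho_of (set_coord k p v)) (z_of (set_coord k p v))) (coord k p)
      (lx * dr + ly * dz)).
  { intros F lx ly HF. apply is_derive_comp_2d; trivial. rewrite Ep, Hr. exact HF. }
  transitivity (Derive (fun v => let q := set_coord k p v in
    exp (2 * Al (rho_of q) (z_of q) - 2 * U (rho_of q) (z_of q)) *
      (cyl_jac c1 a q * cyl_jac c1 b q + cyl_jac c2 a q * cyl_jac c2 b q) +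
    rho_of q ^ 2 * exp (- 2 * U (rho_of q) (z_of q)) * (cyl_jac c3 a q * cyl_jac c3 b q))
    (coord k p)).
  { apply Derive_ext_loc. generalize (rho_of_pos_locally k p ltac:(lra)).
    apply filter_imp. intros v Hv. exact (profile_cart _ _ _ _ _ _ _ _ _ _ _ _ _ H a b _ Hv). }
  apply is_derive_unique. cbv zeta.
  pose proof (is_derive_metric_product _ _ _ _ _ _ _ _ _ _ _ _ _ _ _ _ _ _ _
    (DF _ _ _ (C2_d _ _ _ _ _ _ (prof_A _ _ _ _ _ _ _ _ _ _ _ _ _ H) t z))
    (DF _ _ _ (C2_d _ _ _ _ _ _ (prof_U _ _ _ _ _ _ _ _ _ _ _ _ _ H) t z))
    Dr (DX c1 a) (DX c1 b) (DX c2 a) (DX c2 b) (DX c3 a) (DX c3 b)) as D.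
  cbv beta in D. rewrite Ep, Hr in D. rewrite !HX in D. exact D.
Qed.

(* The integrand of [adm_flux], which does not depend on [phi], for [P = e^(2 alpha - 2 u)]
   and [Q = e^(-2 u)]: the bracket is [- P_r - Q_r + (P - Q) / r]. *)
Definition flux_density (U U1 U2 Al A1 A2 : R -> R -> R) (r theta : R) : R :=
  let S := sin theta in let C := cos theta in
  let x := r * S in let z := r * C in
  let P := exp (2 * Al x z - 2 * U x z) in
  let Q := exp (- 2 * U x z) in
  (- (P * (2 * (S * A1 x z + C * A2 x z) - 2 * (S * U1 x z + C * U2 x z)))
   + Q * (2 * (S * U1 x z + C * U2 x z)) + (P - Q) / r) * (r ^ 2 * S).

Lemma profile_flux g U U1 U2 U11 U12 U22 Al A1 A2 A11 A12 A22
    (H : profile g U U1 U2 U11 U12 U22 Al A1 A2 A11 A12 A22) r :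
  0 < r ->
  adm_flux (cart g) r = RInt (fun theta => 2 * PI * flux_density U U1 U2 Al A1 A2 r theta) 0 PI.
Proof.
  intros Hr. pose proof PI_RGT_0 as HPI. unfold adm_flux.
  (* Only interior angles matter, so the points lie off the axis, where the cylindrical formula for
     [cart] holds. *)
  apply RInt_ext. intros th Hth. rewrite Rmin_left, Rmax_right in Hth by lra.
  pose proof (sin_gt_0 th ltac:(lra) ltac:(lra)) as HS.
  rewrite (RInt_ext _ (fun _ => flux_density U U1 U2 Al A1 A2 r th)).
  { rewrite RInt_const. unfold scal. cbn. unfold mult. cbn. now rewrite Rminus_0_r. }
  intros ph _. cbv zeta.
  set (S := sin th) in *. set (C := cos th). set (c := cos ph). set (s := sin ph).
  assert (Hcs : c ^ 2 + s ^ 2 = 1).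
  { pose proof (sin2_cos2 ph) as E. unfold Rsqr in E. unfold c, s. rewrite <- E. ring. }
  assert (Ep : scale_point r (sphere_normal th ph) = (r * S * c, r * S * s, r * C)).
  { unfold scale_point, sphere_normal. cbn. fold S C c s. apply f_equal2; [apply f_equal2|]; ring. }
  rewrite Ep.
  assert (Ht : 0 < r * S) by nra.
  unfold sum3.
  rewrite !(profile_cart_partial _ _ _ _ _ _ _ _ _ _ _ _ _ H _ _ _ _ _ _ _ Ht Hcs).
  unfold flux_density, sphere_normal. fold S C c s.
  cbn -[pow exp Rdiv].
  set (P := exp (2 * _ - _)). set (Q := exp (- 2 * _)).
  assert (s2 : s ^ 2 = 1 - c ^ 2) by lra.
  field [s2]. split; lra.
Qed.

(** * Flux integrals over half-circles *)

Lemma continuity_2d_pt_comp_2d F f g x y :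
  continuity_2d_pt F (f x y) (g x y) ->
  continuity_2d_pt f x y -> continuity_2d_pt g x y ->
  continuity_2d_pt (fun u v => F (f u v) (g u v)) x y.
Proof.
  intros HF Hf Hg eps. destruct (HF eps) as [d Hd].
  generalize (locally_2d_and _ _ _ _ (Hf d) (Hg d)).
  apply locally_2d_impl, locally_2d_forall. intros u v [H1 H2]. now apply Hd.
Qed.

Lemma continuity_2d_pt_pow f n x y :
  continuity_2d_pt f x y -> continuity_2d_pt (fun u v => f u v ^ n) x y.
Proof.
  intros Hf. induction n as [|n IH]; simpl.
  - apply continuity_2d_pt_const.
  - now apply continuity_2d_pt_mult.
Qed.

Lemma continuity_2d_pt_snd F x y : continuity_2d_pt F x y -> continuous (F x) y.
Proof.
  intros HF. apply continuity_pt_filterlim. intros eps Heps.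
  destruct (HF (mkposreal _ Heps)) as [d Hd].
  exists d. split; [apply cond_pos|]. intros v [_ Hv].
  apply Hd; [|exact Hv]. rewrite Rminus_diag, Rabs_R0. apply cond_pos.
Qed.

(** Four properties govern the choice. It vanishes on the axis, so no flux passes there. The square
    of [weight x / x] is at most [x], so Young's inequality can be paid for by an energy density
    that degenerates like [x] at the axis. It is at most 1, so the flux of [weight Dw] at radius [r]
    is [O(1/r)]. Its derivative is positive for [x > 0], so [w_rho] is detected away from the
    axis. *)
Definition weight (x : R) : R := x ^ 2 / (1 + x ^ 2).

Definition weight' (x : R) : R := 2 * x / (1 + x ^ 2) ^ 2.

Lemma weight_denom_pos x : 0 < 1 + x ^ 2.
Proof. pose proof (pow2_ge_0 x). lra. Qed.

Lemma is_derive_weight x : is_derive weight x (weight' x).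
Proof.
  pose proof (weight_denom_pos x). unfold weight, weight'. auto_derive.
  - simpl in *. lra.
  - field. lra.
Qed.

Lemma continuity_pt_weight x : continuity_pt weight x.
Proof.
  apply continuity_pt_filterlim, (ex_derive_continuous (V := R_NormedModule)).
  eexists. apply is_derive_weight.
Qed.

Lemma continuity_pt_weight' x : continuity_pt weight' x.
Proof.
  apply continuity_pt_filterlim, (ex_derive_continuous (V := R_NormedModule)).
  unfold weight'. auto_derive.
  pose proof (weight_denom_pos x). simpl in *. apply Rgt_not_eq. nra.
Qed.

Ltac cont2d :=
  repeat match goal with
  | |- continuity_2d_pt (fun u v => @?f u v + @?g u v) _ _ => apply (continuity_2d_pt_plus f g)
  | |- continuity_2d_pt (fun u v => @?f u v - @?g u v) _ _ => apply (continuity_2d_pt_minus f g)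
  | |- continuity_2d_pt (fun u v => @?f u v * @?g u v) _ _ => apply (continuity_2d_pt_mult f g)
  | |- continuity_2d_pt (fun u v => - @?f u v) _ _ => apply (continuity_2d_pt_opp f)
  | |- continuity_2d_pt (fun u v => @?f u v ^ ?n) _ _ => apply (continuity_2d_pt_pow f n)
  | |- continuity_2d_pt (fun u v => exp (@?f u v)) _ _ =>
      apply (continuity_1d_2d_pt_comp exp f);
      [apply derivable_continuous_pt, derivable_pt_exp|]
  | |- continuity_2d_pt (fun u v => weight (@?f u v)) _ _ =>
      apply (continuity_1d_2d_pt_comp weight f); [apply continuity_pt_weight|]
  | |- continuity_2d_pt (fun u v => weight' (@?f u v)) _ _ =>
      apply (continuity_1d_2d_pt_comp weight' f); [apply continuity_pt_weight'|]
  | |- continuity_2d_pt (fun u v => ?c) _ _ => apply (continuity_2d_pt_const _ _ c)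
  | |- continuity_2d_pt (fun u v => u) _ _ => apply continuity_2d_pt_id1
  | |- continuity_2d_pt (fun u v => v) _ _ => apply continuity_2d_pt_id2
  | |- continuity_2d_pt (fun u v => sin v) ?x ?y =>
      apply (continuity_1d_2d_pt_comp sin (fun _ v => v) x y);
      [apply continuity_sin | apply continuity_2d_pt_id2]
  | |- continuity_2d_pt (fun u v => cos v) ?x ?y =>
      apply (continuity_1d_2d_pt_comp cos (fun _ v => v) x y);
      [apply continuity_cos | apply continuity_2d_pt_id2]
  | H : forall x y, continuity_2d_pt ?F x y |- continuity_2d_pt (fun u v => ?F (@?f u v) (@?g u v)) ?x ?y =>
      apply (continuity_2d_pt_comp_2d F f g x y (H _ _))
  end.

Lemma C2_continuity F F1 F2 F11 F12 F22 : C2 F F1 F2 F11 F12 F22 ->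
  (forall x y, continuity_2d_pt F x y) /\
  (forall x y, continuity_2d_pt F1 x y) /\ (forall x y, continuity_2d_pt F2 x y) /\
  (forall x y, continuity_2d_pt F11 x y) /\ (forall x y, continuity_2d_pt F12 x y) /\
  (forall x y, continuity_2d_pt F22 x y).
Proof.
  intros [H0 H1 H2 H11 H12 H22]. repeat split; trivial; intros x y;
  eapply differentiable_pt_lim_continuity; eauto.
Qed.

Lemma differentiable_pt_lim_lin F G a b x y lx ly mx my :
  differentiable_pt_lim F x y lx ly -> differentiable_pt_lim G x y mx my ->
  differentiable_pt_lim (fun u v => a * F u v + b * G u v) x y
    (a * lx + b * mx) (a * ly + b * my).
Proof.
  intros HF HG.
  apply (differentiable_pt_lim_comp (fun u v => a * u + b * v) F G); trivial.
  intros eps. exists (mkposreal 1 Rlt_0_1). intros u v _ _.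
  match goal with |- Rabs ?e <= _ => replace e with 0 by ring end.
  rewrite Rabs_R0. apply Rmult_le_pos; [apply Rlt_le, cond_pos|].
  apply Rle_trans with (2 := Rmax_l _ _), Rabs_pos.
Qed.

Lemma C2_lin F F1 F2 F11 F12 F22 G G1 G2 G11 G12 G22 a b :
  C2 F F1 F2 F11 F12 F22 -> C2 G G1 G2 G11 G12 G22 ->
  C2 (fun x y => a * F x y + b * G x y) (fun x y => a * F1 x y + b * G1 x y)
    (fun x y => a * F2 x y + b * G2 x y) (fun x y => a * F11 x y + b * G11 x y)
    (fun x y => a * F12 x y + b * G12 x y) (fun x y => a * F22 x y + b * G22 x y).
Proof.
  intros [F0 FF1 FF2 c11 c12 c22] [G0 GG1 GG2 d11 d12 d22].
  split; intros; try (now apply differentiable_pt_lim_lin); cont2d; trivial.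
Qed.

Lemma is_derive_RInt_param_continuous (f f' : R -> R -> R) a b r :
  (forall r t, is_derive (fun s => f s t) r (f' r t)) ->
  (forall r t, continuity_2d_pt f r t) -> (forall r t, continuity_2d_pt f' r t) ->
  is_derive (fun r => RInt (f r) a b) r (RInt (f' r) a b).
Proof.
  intros D Cf Cf'.
  rewrite (RInt_ext (f' r) (fun t => Derive (fun s => f s t) r)).
  2:{ intros t _. symmetry. apply is_derive_unique, D. }
  apply (is_derive_RInt_param f).
  - apply filter_forall. intros s t _. eexists. apply D.
  - intros t _. apply continuity_2d_pt_ext with f'; trivial.
    intros s v. symmetry. apply is_derive_unique, D.
  - apply filter_forall. intros s. apply (ex_RInt_continuous (V := R_CompleteNormedModule)).
    intros t _. now apply continuity_2d_pt_snd.
Qed.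

(* A flux through half-circles, differentiated in the radius up to an angular divergence. *)
Lemma is_derive_flux (f f' : R -> R -> R) (n m dm : R -> R) r :
  (forall r t, is_derive (fun s => f s t) r (f' r t)) ->
  (forall r t, continuity_2d_pt f r t) -> (forall r t, continuity_2d_pt f' r t) ->
  (forall t, is_derive m t (dm t)) -> (forall t, continuous dm t) ->
  m PI = m 0 -> (forall t, f' r t = n t + dm t) ->
  is_derive (fun r => RInt (f r) 0 PI) r (RInt n 0 PI) /\ ex_RInt n 0 PI.
Proof.
  intros D Cf Cf' Dm Cm Em E.
  assert (I : is_RInt n 0 PI (RInt (f' r) 0 PI)).
  { replace (RInt (f' r) 0 PI) with (RInt (f' r) 0 PI - (m PI - m 0)) by (rewrite Em; ring).
    apply (is_RInt_ext (fun t => f' r t - dm t)).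
    - intros t _. change (f' r t - dm t = n t). rewrite E. ring.
    - apply (is_RInt_minus (V := R_NormedModule)).
      + apply (RInt_correct (V := R_CompleteNormedModule)),
          (ex_RInt_continuous (V := R_CompleteNormedModule)).
        intros t _. now apply continuity_2d_pt_snd.
      + apply (is_RInt_derive (V := R_CompleteNormedModule) m dm); intros t _; trivial. }
  split; [|now exists (RInt (f' r) 0 PI)].
  rewrite (is_RInt_unique _ _ _ _ I). now apply is_derive_RInt_param_continuous.
Qed.

Lemma is_derive_radial F r t lx ly :
  differentiable_pt_lim F (r * sin t) (r * cos t) lx ly ->
  is_derive (fun s => F (s * sin t) (s * cos t)) r (sin t * lx + cos t * ly).
Proof.
  intros HF. evar_last.
  - apply is_derive_comp_2d; [exact HF | auto_derive; trivial ..].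
  - cbn. ring.
Qed.

Lemma is_derive_angular F r t lx ly :
  differentiable_pt_lim F (r * sin t) (r * cos t) lx ly ->
  is_derive (fun s => F (r * sin s) (r * cos s)) t (r * cos t * lx - r * sin t * ly).
Proof.
  intros HF. evar_last.
  - apply is_derive_comp_2d; [exact HF | auto_derive; trivial ..].
  - cbn. ring.
Qed.

Ltac derive_abstract :=
  intros; auto_derive;
  [ repeat split; first [exact I | eexists; eassumption]
  | repeat match goal with
    | H : is_derive ?f ?x _ |- context [Derive ?g ?x] =>
        rewrite (is_derive_unique _ _ _ H : Derive g x = _)
    end; unfold Rminus; cbn; ring ].

(* The part of [flux_density] linear in [u] and [alpha]; with [u_r], [alpha_r] the radial
   derivatives it is [(4 u_r - 2 alpha_r + 2 alpha / r) r^2 sin t]. *)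
Definition mass_density (U1 U2 Al A1 A2 : R -> R -> R) (r t : R) : R :=
  ((4 * (sin t * U1 (r * sin t) (r * cos t) + cos t * U2 (r * sin t) (r * cos t))
    - 2 * (sin t * A1 (r * sin t) (r * cos t) + cos t * A2 (r * sin t) (r * cos t))) * r ^ 2
   + 2 * r * Al (r * sin t) (r * cos t)) * sin t.

(* [r rho N] for [N = e^(2 alpha - 2 u) R_g + 2 |Du|^2], cleared of the denominator [rho]. *)
Definition curvature_density (U1 U11 U22 A11 A22 : R -> R -> R) (r t : R) : R :=
  r ^ 2 * sin t * (4 * (U11 (r * sin t) (r * cos t) + U22 (r * sin t) (r * cos t))
                   - 2 * (A11 (r * sin t) (r * cos t) + A22 (r * sin t) (r * cos t)))
  + 4 * r * U1 (r * sin t) (r * cos t).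

Lemma is_derive_mass_density_aux (u1 u2 al a1 a2 : R -> R) S C r du1 du2 dal da1 da2 :
  is_derive u1 r du1 -> is_derive u2 r du2 -> is_derive al r dal ->
  is_derive a1 r da1 -> is_derive a2 r da2 ->
  is_derive (fun r => ((4 * (S * u1 r + C * u2 r) - 2 * (S * a1 r + C * a2 r)) * r ^ 2
                       + 2 * r * al r) * S) r
    (((4 * (S * du1 + C * du2) - 2 * (S * da1 + C * da2)) * r ^ 2
      + (4 * (S * u1 r + C * u2 r) - 2 * (S * a1 r + C * a2 r)) * (2 * r)
      + 2 * al r + 2 * r * dal) * S).
Proof. derive_abstract. Qed.

(** The differentiated function is minus the angular component of
    [4 rho Du - 2 rho Dalpha + 2 alpha e_rho]; its derivative accounts for the part of the
    divergence missed by the radial derivative of the flux. *)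
Lemma is_derive_mass_angular_aux (u1 u2 al a1 a2 : R -> R) r t du1 du2 dal da1 da2 :
  is_derive u1 t du1 -> is_derive u2 t du2 -> is_derive al t dal ->
  is_derive a1 t da1 -> is_derive a2 t da2 ->
  is_derive (fun t => - 4 * sin t * (r * (cos t * u1 t - sin t * u2 t))
      + 2 * sin t * (r * (cos t * a1 t - sin t * a2 t)) - 2 * cos t * al t) t
    (- 4 * cos t * (r * (cos t * u1 t - sin t * u2 t))
     - 4 * sin t * (r * (- sin t * u1 t + cos t * du1 - cos t * u2 t - sin t * du2))
     + 2 * cos t * (r * (cos t * a1 t - sin t * a2 t))
     + 2 * sin t * (r * (- sin t * a1 t + cos t * da1 - cos t * a2 t - sin t * da2))
     + 2 * sin t * al t - 2 * cos t * dal).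
Proof. derive_abstract. Qed.

(** The divergence theorem for the field with divergence [rho N]. At [t = 0] and [t = PI] its
    angular component reduces to plus or minus [2 alpha] on the axis, which is zero. *)
Lemma is_derive_mass_density U U1 U2 U11 U12 U22 Al A1 A2 A11 A12 A22 r :
  C2 U U1 U2 U11 U12 U22 -> C2 Al A1 A2 A11 A12 A22 -> (forall z, Al 0 z = 0) ->
  is_derive (fun r => RInt (mass_density U1 U2 Al A1 A2 r) 0 PI) r
    (RInt (curvature_density U1 U11 U22 A11 A22 r) 0 PI)
  /\ ex_RInt (curvature_density U1 U11 U22 A11 A22 r) 0 PI.
Proof.
  intros CU CA axis.
  destruct (C2_continuity _ _ _ _ _ _ CU) as (k0 & k1 & k2 & k11 & k12 & k22).
  destruct (C2_continuity _ _ _ _ _ _ CA) as (l0 & l1 & l2 & l11 & l12 & l22).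
  pose proof (C2_d1 _ _ _ _ _ _ CU) as DU1. pose proof (C2_d2 _ _ _ _ _ _ CU) as DU2.
  pose proof (C2_d _ _ _ _ _ _ CA) as DA.
  pose proof (C2_d1 _ _ _ _ _ _ CA) as DA1. pose proof (C2_d2 _ _ _ _ _ _ CA) as DA2.
  eapply (is_derive_flux (mass_density U1 U2 Al A1 A2)).
  - intros s t. eapply (is_derive_mass_density_aux
      (fun s => U1 (s * sin t) (s * cos t)) (fun s => U2 (s * sin t) (s * cos t))
      (fun s => Al (s * sin t) (s * cos t)) (fun s => A1 (s * sin t) (s * cos t))
      (fun s => A2 (s * sin t) (s * cos t)) (sin t) (cos t));
    eapply is_derive_radial; auto.
  - intros s t. unfold mass_density. cont2d.
  - intros s t. cbv beta. cont2d.
  - intros t. eapply (is_derive_mass_angular_aux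
      (fun t => U1 (r * sin t) (r * cos t)) (fun t => U2 (r * sin t) (r * cos t))
      (fun t => Al (r * sin t) (r * cos t)) (fun t => A1 (r * sin t) (r * cos t))
      (fun t => A2 (r * sin t) (r * cos t)) r);
    eapply is_derive_angular; auto.
  - intros t. cbv beta.
    match goal with |- continuous (fun t => @?f t) _ =>
      apply (continuity_2d_pt_snd (fun _ t => f t) 0) end.
    cont2d.
  - cbv beta. rewrite sin_PI, sin_0, cos_PI, cos_0, !Rmult_0_r, !axis. ring.
  - intros t. cbv beta. unfold curvature_density.
    assert (s2 : sin t ^ 2 = 1 - cos t ^ 2).
    { pose proof (sin2_cos2 t) as E. unfold Rsqr in E. lra. }
    ring [s2].
Qed.

(** The radial flux of [weight(rho) Dw]; [axial_source] is its divergence times the Jacobian [r] of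
    polar coordinates. *)
Definition axial_density (W1 W2 : R -> R -> R) (r t : R) : R :=
  weight (r * sin t)
  * (sin t * W1 (r * sin t) (r * cos t) + cos t * W2 (r * sin t) (r * cos t)) * r.

Definition axial_source (W1 W11 W22 : R -> R -> R) (r t : R) : R :=
  r * (weight (r * sin t) * (W11 (r * sin t) (r * cos t) + W22 (r * sin t) (r * cos t))
       + weight' (r * sin t) * W1 (r * sin t) (r * cos t)).

Lemma is_derive_axial_aux (p w1 w2 : R -> R) S C r dp dw1 dw2 :
  is_derive p r dp -> is_derive w1 r dw1 -> is_derive w2 r dw2 ->
  is_derive (fun r => p r * (S * w1 r + C * w2 r) * r) r
    (dp * (S * w1 r + C * w2 r) * r + p r * (S * dw1 + C * dw2) * r
     + p r * (S * w1 r + C * w2 r)).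
Proof. derive_abstract. Qed.

Lemma is_derive_axial_angular_aux (p w1 w2 : R -> R) t dp dw1 dw2 :
  is_derive p t dp -> is_derive w1 t dw1 -> is_derive w2 t dw2 ->
  is_derive (fun t => - (p t * (cos t * w1 t - sin t * w2 t))) t
    (- (dp * (cos t * w1 t - sin t * w2 t)
        + p t * (- sin t * w1 t + cos t * dw1 - cos t * w2 t - sin t * dw2))).
Proof. derive_abstract. Qed.

Lemma is_derive_weight_comp f t df :
  is_derive f t df -> is_derive (fun s => weight (f s)) t (df * weight' (f t)).
Proof.
  intros Hf. apply (is_derive_comp weight f t (weight' (f t)) df); trivial.
  apply is_derive_weight.
Qed.

Lemma is_derive_axial_density W W1 W2 W11 W12 W22 r :
  C2 W W1 W2 W11 W12 W22 ->
  is_derive (fun r => RInt (axial_density W1 W2 r) 0 PI) r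
    (RInt (axial_source W1 W11 W22 r) 0 PI)
  /\ ex_RInt (axial_source W1 W11 W22 r) 0 PI.
Proof.
  intros CW.
  destruct (C2_continuity _ _ _ _ _ _ CW) as (k0 & k1 & k2 & k11 & k12 & k22).
  pose proof (C2_d1 _ _ _ _ _ _ CW) as DW1. pose proof (C2_d2 _ _ _ _ _ _ CW) as DW2.
  eapply (is_derive_flux (axial_density W1 W2)).
  - intros s t. eapply (is_derive_axial_aux (fun s => weight (s * sin t))
      (fun s => W1 (s * sin t) (s * cos t)) (fun s => W2 (s * sin t) (s * cos t)) (sin t) (cos t)).
    + apply (is_derive_weight_comp (fun s => s * sin t)). auto_derive; [trivial | reflexivity].
    + eapply is_derive_radial; auto.
    + eapply is_derive_radial; auto.
  - intros s t. unfold axial_density. cont2d.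
  - intros s t. cbv beta. cont2d.
  - intros t. eapply (is_derive_axial_angular_aux (fun t => weight (r * sin t))
      (fun t => W1 (r * sin t) (r * cos t)) (fun t => W2 (r * sin t) (r * cos t))).
    + apply (is_derive_weight_comp (fun t => r * sin t)). auto_derive; [trivial | reflexivity].
    + eapply is_derive_angular; auto.
    + eapply is_derive_angular; auto.
  - intros t. cbv beta.
    match goal with |- continuous (fun t => @?f t) _ =>
      apply (continuity_2d_pt_snd (fun _ t => f t) 0) end.
    cont2d.
  - cbv beta. rewrite sin_PI, sin_0, cos_PI, cos_0, !Rmult_0_r. unfold weight. field.
  - intros t. cbv beta. unfold axial_source.
    assert (s2 : sin t ^ 2 = 1 - cos t ^ 2).
    { pose proof (sin2_cos2 t) as E. unfold Rsqr in E. lra. }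
    ring [s2].
Qed.

(** From [N >= 2 |Du|^2] only [u_rho^2] is kept, the derivative that is later integrated along lines
    parallel to the [rho]-axis. *)
Lemma curvature_density_lower_bound U1 U2 U11 U22 A11 A22 r t :
  (forall x z, 0 < x -> 0 <= 4 * (U11 x z + U22 x z) + 4 * U1 x z / x
     - 2 * (A11 x z + A22 x z) - 2 * (U1 x z ^ 2 + U2 x z ^ 2)) ->
  0 <= r -> 0 < t < PI ->
  2 * r * (r * sin t) * U1 (r * sin t) (r * cos t) ^ 2 <= curvature_density U1 U11 U22 A11 A22 r t.
Proof.
  intros Hs Hr Ht. pose proof (sin_gt_0 t ltac:(lra) ltac:(lra)) as HS.
  unfold curvature_density. destruct Hr as [Hr|<-]; [|lra].
  assert (Hx : 0 < r * sin t) by nra.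
  specialize (Hs _ (r * cos t) Hx).
  set (x := r * sin t) in *. set (z := r * cos t) in *.
  replace (r ^ 2 * sin t) with (r * x) by (unfold x; ring).
  replace (4 * r * U1 x z) with (r * x * (4 * U1 x z / x)) by (field; now apply Rgt_not_eq).
  assert (0 < r * x) by nra. pose proof (pow2_ge_0 (U2 x z)). nra.
Qed.

(* Young's inequality absorbs the first-order term [4 weight U1 / x] into the
   Dirichlet energy contained in [curvature_density]. *)
Lemma axial_source_lower_bound U1 U2 U11 U22 A1 A11 A22 lam r t :
  (forall x z, 0 < x -> 0 <= 4 * (U11 x z + U22 x z) + 4 * U1 x z / x
     - 2 * (A11 x z + A22 x z) - 2 * (U1 x z ^ 2 + U2 x z ^ 2)) ->
  0 < lam -> 0 <= r -> 0 < t < PI ->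
  2 * r * weight' (r * sin t)
      * - (1 * A1 (r * sin t) (r * cos t) + - 2 * U1 (r * sin t) (r * cos t))
  <= - 2 * axial_source (fun x y => 1 * A1 x y + - 2 * U1 x y)
         (fun x y => 1 * A11 x y + - 2 * U11 x y) (fun x y => 1 * A22 x y + - 2 * U22 x y) r t
     + / lam * curvature_density U1 U11 U22 A11 A22 r t + 2 * lam * r.
Proof.
  intros Hs Hlam Hr Ht. pose proof (sin_gt_0 t ltac:(lra) ltac:(lra)) as HS.
  unfold curvature_density, axial_source. destruct Hr as [Hr|<-]; [|lra].
  assert (Hx : 0 < r * sin t) by nra.
  specialize (Hs _ (r * cos t) Hx).
  replace (r ^ 2 * sin t) with (r * (r * sin t)) by ring.
  set (x := r * sin t) in *. set (z := r * cos t) in *.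
  set (N := 4 * (U11 x z + U22 x z) + 4 * U1 x z / x - 2 * (A11 x z + A22 x z)).
  set (v := U1 x z) in *.
  assert (HN : 2 * v ^ 2 <= N).
  { unfold N. pose proof (pow2_ge_0 (U2 x z)). lra. }
  pose proof (weight_denom_pos x) as Hd.
  assert (Hd0 : 1 + x ^ 2 <> 0) by now apply Rgt_not_eq.
  assert (Hx0 : x <> 0) by now apply Rgt_not_eq.
  assert (Hlam0 : lam <> 0) by now apply Rgt_not_eq.
  set (tau := x / (1 + x ^ 2)).
  (* [tau] is [weight x / x]. The bound reduces to [x <= (1 + x^2)^2] and lets [x * N >= 2 x v^2]
     dominate [2 tau^2 v^2] right up to the axis. *)
  assert (Htau : tau ^ 2 <= x).
  { unfold tau. apply Rmult_le_reg_r with ((1 + x ^ 2) ^ 2); [nra|].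
    replace ((x / (1 + x ^ 2)) ^ 2 * (1 + x ^ 2) ^ 2) with (x ^ 2) by (field; trivial).
    replace (x ^ 2) with (x * x) at 1 by ring.
    apply Rmult_le_compat_l; [lra|].
    assert (2 * x <= 1 + x ^ 2) by (pose proof (pow2_ge_0 (x - 1)); lra).
    pose proof (pow2_ge_0 x). nra. }
  assert (Hw : weight x = x * tau) by (unfold weight, tau; field; trivial).
  assert (Hw0 : 0 <= weight x).
  { unfold weight. apply Rdiv_le_0_compat; [apply pow2_ge_0 | exact Hd]. }
  assert (Key : 0 <= weight x * N - 4 * tau * v + / lam * x * N + 2 * lam).
  { assert (0 <= weight x * N) by (apply Rmult_le_pos; [|pose proof (pow2_ge_0 v)]; lra).
    (* Completing the square gives [4 tau v <= (2 / lam) tau^2 v^2 + 2 lam]. *)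
    assert (E : / lam * (tau * v - lam) ^ 2 = / lam * (tau ^ 2 * v ^ 2) - 2 * tau * v + lam)
      by (field; trivial).
    assert (0 <= / lam * (tau * v - lam) ^ 2).
    { apply Rmult_le_pos; [apply Rlt_le, Rinv_0_lt_compat, Hlam | apply pow2_ge_0]. }
    assert (/ lam * (2 * (tau ^ 2 * v ^ 2)) <= / lam * (x * N)).
    { apply Rmult_le_compat_l; [apply Rlt_le, Rinv_0_lt_compat, Hlam|].
      pose proof (pow2_ge_0 v). nra. }
    lra. }
  apply Rminus_le_0.
  match goal with |- 0 <= ?e =>
    replace e with (r * (weight x * N - 4 * tau * v + / lam * x * N + 2 * lam)) end.
  - apply Rmult_le_pos; lra.
  - unfold N. rewrite Hw. field. split; trivial.
Qed.

(** * Decay and the mass *)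

Definition decay (C R0 : R) (F F1 F2 F11 F12 F22 : R -> R -> R) : Prop :=
  forall x z, 0 < x -> R0 <= sqrt (x ^ 2 + z ^ 2) ->
  let r := sqrt (x ^ 2 + z ^ 2) in
  Rabs (F x z) <= C / r /\
  (Rabs (F1 x z) <= C / r ^ 2 /\ Rabs (F2 x z) <= C / r ^ 2) /\
  (Rabs (F11 x z) <= C / r ^ 3 /\ Rabs (F12 x z) <= C / r ^ 3 /\ Rabs (F22 x z) <= C / r ^ 3).

Lemma d_rho_z_C2 f F F1 F2 F11 F12 F22 x z :
  C2 F F1 F2 F11 F12 F22 -> (forall x z, 0 <= x -> f x z = F x z) -> 0 < x ->
  d_rho_z 0 0 f x z = F x z /\
  (d_rho_z 1 0 f x z = F1 x z /\ d_rho_z 0 1 f x z = F2 x z) /\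
  (d_rho_z 2 0 f x z = F11 x z /\ d_rho_z 1 1 f x z = F12 x z /\ d_rho_z 0 2 f x z = F22 x z).
Proof.
  intros CF E Hx. C2_facts.
  assert (L : forall (g h : R -> R) y, 0 < y -> (forall s, 0 < s -> g s = h s) ->
    Derive g y = Derive h y).
  { intros g h y Hy Egh. apply Derive_ext_loc. exists (mkposreal _ Hy). intros t Ht.
    apply Egh. unfold ball in Ht. cbn in Ht. unfold AbsRing_ball, abs, minus, plus, opp in Ht.
    cbn in Ht. apply Rabs_def2 in Ht. lra. }
  assert (D1 : forall y, 0 < y -> Derive (fun s => f s z) y = F1 y z).
  { intros y Hy. rewrite (L _ (fun s => F s z)); trivial.
    - slice_value. reflexivity.
    - intros s Hs. apply E. lra. }
  assert (D2 : forall y w, 0 < y -> Derive (fun s => f y s) w = F2 y w).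
  { intros y w Hy. rewrite (Derive_ext _ (fun s => F y s)).
    - slice_value. reflexivity.
    - intros s. apply E. lra. }
  unfold d_rho_z. cbn. repeat split.
  - apply E. lra.
  - now apply D1.
  - now apply D2.
  - rewrite (L _ (fun s => F1 s z)); trivial. slice_value. reflexivity.
  - rewrite (L _ (fun s => F2 s z)); trivial.
    + slice_value. reflexivity.
    + intros s Hs. now apply D2.
  - rewrite (Derive_ext _ (fun s => F2 x s)).
    + slice_value. reflexivity.
    + intros s. now apply D2.
Qed.

Lemma flat_decay M R0 : 0 < R0 -> uniformly_asymptotically_flat M R0 ->
  exists C, 0 < C /\
  forall g U U1 U2 U11 U12 U22 Al A1 A2 A11 A12 A22,
  M g -> profile g U U1 U2 U11 U12 U22 Al A1 A2 A11 A12 A22 ->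
  decay C R0 U U1 U2 U11 U12 U22 /\ decay C R0 Al A1 A2 A11 A12 A22.
Proof.
  (* The maximum with 1 makes the common constant positive. *)
  intros HR0 [C0 HC]. exists (Rmax 1 C0).
  split; [apply Rlt_le_trans with (1 := Rlt_0_1), Rmax_l|].
  intros g U U1 U2 U11 U12 U22 Al A1 A2 A11 A12 A22 Hg H.
  assert (L : forall v r n, 0 < r -> Rabs v <= C0 / r ^ n -> Rabs v <= Rmax 1 C0 / r ^ n).
  { intros v r n Hr Hv. apply Rle_trans with (1 := Hv).
    apply Rmult_le_compat_r; [|apply Rmax_r]. apply Rlt_le, Rinv_0_lt_compat, pow_lt, Hr. }
  split; intros x z Hx Hr; specialize (HC g Hg x z Hx Hr); cbv zeta in *;
    set (r := sqrt (x ^ 2 + z ^ 2)) in *; assert (0 < r) by lra;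
    pose proof (HC 0%nat 0%nat ltac:(lia)) as H00; pose proof (HC 1%nat 0%nat ltac:(lia)) as H10;
    pose proof (HC 0%nat 1%nat ltac:(lia)) as H01; pose proof (HC 2%nat 0%nat ltac:(lia)) as H20;
    pose proof (HC 1%nat 1%nat ltac:(lia)) as H11; pose proof (HC 0%nat 2%nat ltac:(lia)) as H02.
  - destruct (d_rho_z_C2 _ _ _ _ _ _ _ x z (prof_U _ _ _ _ _ _ _ _ _ _ _ _ _ H)
      (prof_u _ _ _ _ _ _ _ _ _ _ _ _ _ H) Hx) as (E00 & (E10 & E01) & E20 & E11 & E02).
    rewrite E00 in H00. rewrite E10 in H10. rewrite E01 in H01.
    rewrite E20 in H20. rewrite E11 in H11. rewrite E02 in H02.
    cbn [Nat.add] in *. rewrite pow_1 in H00.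
    repeat split; try (now apply L).
    rewrite <- (pow_1 r). apply L; trivial. now rewrite pow_1.
  - destruct (d_rho_z_C2 _ _ _ _ _ _ _ x z (prof_A _ _ _ _ _ _ _ _ _ _ _ _ _ H)
      (prof_alpha _ _ _ _ _ _ _ _ _ _ _ _ _ H) Hx) as (E00 & (E10 & E01) & E20 & E11 & E02).
    rewrite E00 in H00. rewrite E10 in H10. rewrite E01 in H01.
    rewrite E20 in H20. rewrite E11 in H11. rewrite E02 in H02.
    cbn [Nat.add] in *. rewrite pow_1 in H00.
    repeat split; try (now apply L).
    rewrite <- (pow_1 r). apply L; trivial. now rewrite pow_1.
Qed.

(** * The nonlinear part of the ADM flux *)

Lemma sqrt_polar r t : 0 <= r -> sqrt ((r * sin t) ^ 2 + (r * cos t) ^ 2) = r.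
Proof.
  intros Hr. pose proof (sin2_cos2 t) as E. unfold Rsqr in E.
  replace ((r * sin t) ^ 2 + (r * cos t) ^ 2)
    with (r ^ 2 * (sin t * sin t + cos t * cos t)) by ring.
  rewrite E, Rmult_1_r. now apply sqrt_pow2.
Qed.

(** Both inequalities come from [1 + y <= e^y], at [y = x] and at [y = -x]. *)
Lemma exp_second_order x : 0 <= exp x - 1 - x <= x * (exp x - 1).
Proof.
  pose proof (exp_ineq1_le x) as H1. pose proof (exp_ineq1_le (- x)) as H2.
  rewrite exp_Ropp in H2. pose proof (exp_pos x) as H3.
  assert (exp x * (1 + - x) <= 1).
  { apply Rle_trans with (exp x * / exp x).
    - apply Rmult_le_compat_l; lra.
    - right. apply Rinv_r. now apply Rgt_not_eq. }
  lra.
Qed.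

Lemma exp_first_order x b : Rabs x <= b -> Rabs (exp x - 1) <= Rabs x * exp b.
Proof.
  intros Hx. pose proof (exp_second_order x) as [H1 H2].
  assert (Hb : exp x <= exp b /\ 1 <= exp b).
  { pose proof (Rabs_pos x). pose proof (Rle_abs x). split.
    - destruct (Req_dec x b) as [->|]; [lra|]. left. apply exp_increasing. lra.
    - pose proof (exp_ineq1_le b). lra. }
  pose proof (exp_pos x). unfold Rabs in *. destruct (Rcase_abs x), (Rcase_abs (exp x - 1)); nra.
Qed.

Lemma exp_second_order_abs x b : Rabs x <= b -> Rabs (exp x - 1 - x) <= x ^ 2 * exp b.
Proof.
  intros Hx. pose proof (exp_second_order x) as [H1 H2].
  rewrite Rabs_pos_eq by trivial. apply Rle_trans with (1 := H2).
  apply Rle_trans with (1 := Rle_abs _). rewrite Rabs_mult.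
  pose proof (exp_first_order x b Hx).
  replace (x ^ 2) with (Rabs x * Rabs x) by (rewrite <- Rabs_mult, Rabs_pos_eq; nra).
  rewrite Rmult_assoc. apply Rmult_le_compat_l; [apply Rabs_pos | trivial].
Qed.

Lemma Rabs_sin_le t : Rabs (sin t) <= 1.
Proof. apply Rabs_le, SIN_bound. Qed.

Lemma Rabs_cos_le t : Rabs (cos t) <= 1.
Proof. apply Rabs_le, COS_bound. Qed.

Lemma Rabs_radial_le t a b M :
  Rabs a <= M -> Rabs b <= M -> Rabs (sin t * a + cos t * b) <= 2 * M.
Proof.
  intros Ha Hb. apply Rle_trans with (1 := Rabs_triang _ _). rewrite !Rabs_mult.
  pose proof (Rabs_sin_le t). pose proof (Rabs_cos_le t).
  pose proof (Rabs_pos a). pose proof (Rabs_pos b). nra.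
Qed.

(** The difference is quadratic: an exponential minus 1 is [O(1/r)] and multiplies first derivatives
    of size [O(1/r^2)], and the second-order remainders divided by [r] are [O(1/r^3)]. The factor
    [r^2] of the area element leaves [O(1/r)]. *)
Lemma flux_density_approx C R0 U U1 U2 U11 U12 U22 Al A1 A2 A11 A12 A22 :
  0 < R0 -> 0 < C -> decay C R0 U U1 U2 U11 U12 U22 -> decay C R0 Al A1 A2 A11 A12 A22 ->
  exists K, forall r t, R0 <= r -> 0 < t < PI ->
  Rabs (flux_density U U1 U2 Al A1 A2 r t - mass_density U1 U2 Al A1 A2 r t) <= K / r.
Proof.
  (* [b] bounds both exponents [p] and [q]; the 60 below is [32 + 8 + 20], from [T1], [T2] and
     [T3]. *)
  intros HR0 HC HU HA. set (b := 4 * C / R0).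
  exists (60 * C ^ 2 * exp b). intros r t Hr Ht.
  assert (Hr0 : 0 < r) by lra.
  pose proof (sin_gt_0 t ltac:(lra) ltac:(lra)) as HS.
  assert (Hx : 0 < r * sin t) by nra.
  pose proof (sqrt_polar r t ltac:(lra)) as E.
  destruct (HU (r * sin t) (r * cos t) Hx ltac:(lra)) as (u0 & (u1 & u2) & _).
  destruct (HA (r * sin t) (r * cos t) Hx ltac:(lra)) as (a0 & (a1 & a2) & _).
  rewrite E in u0, u1, u2, a0, a1, a2. clear HU HA E.
  pose proof (Rabs_radial_le t _ _ _ u1 u2) as Hur.
  pose proof (Rabs_radial_le t _ _ _ a1 a2) as Har.
  unfold flux_density, mass_density.
  set (S := sin t) in *. set (Co := cos t) in *.
  set (x := r * S) in *. set (z := r * Co) in *.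
  set (ur := S * U1 x z + Co * U2 x z) in *. set (ar := S * A1 x z + Co * A2 x z) in *.
  set (p := 2 * Al x z - 2 * U x z). set (q := - 2 * U x z).
  assert (Hq : Rabs q <= 2 * (C / r)).
  { unfold q. rewrite Rabs_mult, (Rabs_left (-2)) by lra. lra. }
  assert (Hp : Rabs p <= 4 * (C / r)).
  { unfold p. replace (2 * Al x z - 2 * U x z) with (2 * Al x z + -2 * U x z) by ring.
    apply Rle_trans with (1 := Rabs_triang _ _). rewrite !Rabs_mult.
    rewrite (Rabs_left (-2)), (Rabs_right 2) by lra. lra. }
  assert (Hcr : 0 < C / r) by now apply Rdiv_lt_0_compat.
  assert (Hb : 4 * (C / r) <= b).
  { unfold b, Rdiv. rewrite Rmult_assoc. apply Rmult_le_compat_l; [lra|].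
    apply Rmult_le_compat_l; [lra|]. now apply Rinv_le_contravar. }
  pose proof (exp_first_order p b ltac:(lra)) as P1.
  pose proof (exp_first_order q b ltac:(lra)) as Q1.
  pose proof (exp_second_order_abs p b ltac:(lra)) as P2.
  pose proof (exp_second_order_abs q b ltac:(lra)) as Q2.
  assert (SQ : forall v m, Rabs v <= m -> v ^ 2 <= m ^ 2).
  { intros v m Hv. rewrite <- pow2_abs. apply pow_incr. split; [apply Rabs_pos | trivial]. }
  apply SQ in Hp as Hp2. apply SQ in Hq as Hq2.
  match goal with |- Rabs ?e <= _ =>
    replace e with ((r ^ 2 * S) * (- ((exp p - 1) * (2 * ar - 2 * ur)) + (exp q - 1) * (2 * ur)
      + ((exp p - 1 - p) - (exp q - 1 - q)) / r)) by (unfold p, q; field; lra) end.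
  pose proof (exp_pos b) as Heb.
  set (e := exp b) in *. set (m := C / r) in *.
  assert (Em : C / r ^ 2 = m / r) by (unfold m; field; lra). rewrite Em in *.
  rewrite Rabs_mult, Rabs_pos_eq by (apply Rmult_le_pos; [apply pow2_ge_0 | lra]).
  assert (T1 : Rabs (- ((exp p - 1) * (2 * ar - 2 * ur))) <= 4 * m * e * (8 * (m / r))).
  { rewrite Rabs_Ropp, Rabs_mult. apply Rmult_le_compat; try apply Rabs_pos.
    - apply Rle_trans with (1 := P1). apply Rmult_le_compat_r; lra.
    - replace (2 * ar - 2 * ur) with (2 * ar + -2 * ur) by ring.
      apply Rle_trans with (1 := Rabs_triang _ _). rewrite !Rabs_mult.
      rewrite (Rabs_left (-2)), (Rabs_right 2) by lra. lra. }
  assert (T2 : Rabs ((exp q - 1) * (2 * ur)) <= 2 * m * e * (4 * (m / r))).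
  { rewrite Rabs_mult. apply Rmult_le_compat; try apply Rabs_pos.
    - apply Rle_trans with (1 := Q1). apply Rmult_le_compat_r; lra.
    - rewrite Rabs_mult, (Rabs_right 2) by lra. lra. }
  assert (T3 : Rabs (((exp p - 1 - p) - (exp q - 1 - q)) / r) <= 20 * m ^ 2 * e / r).
  { unfold Rdiv. rewrite Rabs_mult, (Rabs_pos_eq (/ r))
      by (apply Rlt_le, Rinv_0_lt_compat; lra).
    apply Rmult_le_compat_r; [apply Rlt_le, Rinv_0_lt_compat; lra|].
    unfold Rminus at 1. apply Rle_trans with (1 := Rabs_triang _ _). rewrite Rabs_Ropp.
    assert (p ^ 2 * e <= (4 * m) ^ 2 * e) by (apply Rmult_le_compat_r; lra).
    assert (q ^ 2 * e <= (2 * m) ^ 2 * e) by (apply Rmult_le_compat_r; lra).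
    lra. }
  assert (HS1 : S <= 1) by apply SIN_bound.
  apply Rle_trans with ((r ^ 2 * 1) * (60 * m ^ 2 * e / r)).
  - apply Rmult_le_compat.
    + apply Rmult_le_pos; [apply pow2_ge_0 | lra].
    + apply Rabs_pos.
    + apply Rmult_le_compat_l; [apply pow2_ge_0 | trivial].
    + apply Rle_trans with (1 := Rabs_triang _ _).
      eapply Rle_trans; [apply Rplus_le_compat; [apply Rabs_triang | exact T3]|].
      replace (60 * m ^ 2 * e / r) with
        (4 * m * e * (8 * (m / r)) + 2 * m * e * (4 * (m / r)) + 20 * m ^ 2 * e / r)
        by (field; lra).
      lra.
  - right. unfold m. field. lra.
Qed.

Lemma RInt_bound (f : R -> R) M :
  ex_RInt f 0 PI -> (forall t, 0 < t < PI -> Rabs (f t) <= M) -> Rabs (RInt f 0 PI) <= PI * M.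
Proof.
  intros If Hf. pose proof PI_RGT_0 as HPI.
  assert (EC : forall c : R, RInt (fun _ => c) 0 PI = PI * c).
  { intros c. rewrite RInt_const. unfold scal. cbn. unfold mult. cbn. ring. }
  apply Rabs_le. split.
  - replace (- (PI * M)) with (PI * - M) by ring. rewrite <- EC. apply RInt_le; trivial; [lra | apply ex_RInt_const |].
    intros t Ht. specialize (Hf t Ht). apply Rabs_le_between in Hf. lra.
  - rewrite <- EC. apply RInt_le; trivial; [lra | apply ex_RInt_const |].
    intros t Ht. specialize (Hf t Ht). apply Rabs_le_between in Hf. lra.
Qed.

Lemma RInt_ge_subinterval (f : R -> R) a b c :
  ex_RInt f 0 PI -> 0 <= a -> a <= b -> b <= PI -> (forall t, 0 < t < PI -> 0 <= f t) ->
  (forall t, a < t < b -> c <= f t) -> (b - a) * c <= RInt f 0 PI.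
Proof.
  intros If Ha Hab Hb Hf Hc.
  assert (I1 : ex_RInt f 0 a) by (apply (ex_RInt_Chasles_1 (V := R_CompleteNormedModule)) with PI; trivial; lra).
  assert (I2 : ex_RInt f a PI) by (apply (ex_RInt_Chasles_2 (V := R_CompleteNormedModule)) with 0; trivial; lra).
  assert (I3 : ex_RInt f a b) by (apply (ex_RInt_Chasles_1 (V := R_CompleteNormedModule)) with PI; trivial; lra).
  assert (I4 : ex_RInt f b PI) by (apply (ex_RInt_Chasles_2 (V := R_CompleteNormedModule)) with a; trivial; lra).
  assert (E1 : RInt f 0 a + RInt f a PI = RInt f 0 PI)
    by exact (RInt_Chasles (V := R_CompleteNormedModule) f 0 a PI I1 I2).
  assert (E2 : RInt f a b + RInt f b PI = RInt f a PI)
    by exact (RInt_Chasles (V := R_CompleteNormedModule) f a b PI I3 I4).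
  assert (0 <= RInt f 0 a) by (apply RInt_ge_0; trivial; intros; apply Hf; lra).
  assert (0 <= RInt f b PI) by (apply RInt_ge_0; trivial; intros; apply Hf; lra).
  assert ((b - a) * c <= RInt f a b).
  { replace ((b - a) * c) with (RInt (fun _ => c) a b)
      by (rewrite RInt_const; reflexivity).
    apply RInt_le; trivial. apply ex_RInt_const. }
  lra.
Qed.

Lemma MVT_ge (T dT : R -> R) a b c :
  (forall r, is_derive T r (dT r)) -> a <= b -> (forall r, a <= r <= b -> c <= dT r) ->
  (b - a) * c <= T b - T a.
Proof.
  intros D Hab Hc.
  destruct (MVT_gen T a b dT) as (x & Hx & E).
  - intros r _. apply D.
  - intros r _. apply continuity_pt_filterlim, (ex_derive_continuous (V := R_NormedModule)).
    now exists (dT r).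
  - rewrite Rmin_left, Rmax_right in Hx by trivial. rewrite E.
    rewrite Rmult_comm. apply Rmult_le_compat_r; [lra | now apply Hc].
Qed.

Lemma continuity_RInt_0_PI (f : R -> R -> R) r :
  (forall r t, continuity_2d_pt f r t) -> ex_RInt (f r) 0 PI.
Proof.
  intros Hf. apply (ex_RInt_continuous (V := R_CompleteNormedModule)).
  intros t _. now apply continuity_2d_pt_snd.
Qed.

(** A value above [16 delta] persists at larger radii by monotonicity. There the ADM flux integral
    differs from it by at most [PI * delta <= 4 delta], so the mass would be at least
    [12 delta / 8], more than [delta]. *)
Lemma profile_mass C R0 delta g U U1 U2 U11 U12 U22 Al A1 A2 A11 A12 A22 :
  profile g U U1 U2 U11 U12 U22 Al A1 A2 A11 A12 A22 ->
  0 < R0 -> 0 < C -> decay C R0 U U1 U2 U11 U12 U22 -> decay C R0 Al A1 A2 A11 A12 A22 ->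
  (forall x z, 0 < x -> 0 <= 4 * (U11 x z + U22 x z) + 4 * U1 x z / x
     - 2 * (A11 x z + A22 x z) - 2 * (U1 x z ^ 2 + U2 x z ^ 2)) ->
  0 < delta -> Rbar_lt (mass g) delta ->
  forall r, 0 <= r -> RInt (mass_density U1 U2 Al A1 A2 r) 0 PI <= 16 * delta.
Proof.
  intros H HR0 HC HU HA Hs Hdelta Hm r Hr. pose proof PI_RGT_0 as HPI.
  destruct (Rle_lt_dec (RInt (mass_density U1 U2 Al A1 A2 r) 0 PI) (16 * delta)) as [|Hlt];
    trivial.
  exfalso.
  destruct (flux_density_approx C R0 _ _ _ _ _ _ _ _ _ _ _ _ HR0 HC HU HA) as [K HK].
  destruct (C2_continuity _ _ _ _ _ _ (prof_U _ _ _ _ _ _ _ _ _ _ _ _ _ H))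
    as (k0 & k1 & k2 & _).
  destruct (C2_continuity _ _ _ _ _ _ (prof_A _ _ _ _ _ _ _ _ _ _ _ _ _ H))
    as (l0 & l1 & l2 & _).
  (* [Lim] is taken along the integers and [Lim_seq] is total, so an eventual lower bound passes to
     it without a convergence argument. *)
  apply (Rbar_lt_not_le _ _ Hm). unfold mass, adm_mass, Lim.
  replace (Finite delta) with (Lim_seq (fun _ => delta)) by apply Lim_seq_const.
  apply Lim_seq_le_loc.
  set (N := Rmax (Rmax R0 r) (Rmax 1 (K / delta))).
  destruct (nfloor_ex N) as [n Hn].
  { unfold N. apply Rle_trans with (2 := Rmax_r _ _), Rle_trans with (2 := Rmax_l _ _). lra. }
  exists (S n). intros k Hk. cbn [Rbar_loc_seq].
  assert (Hk' : N < INR k).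
  { apply Rlt_le_trans with (INR n + 1); [tauto|]. rewrite <- S_INR. now apply le_INR. }
  unfold N in Hk'. apply Rmax_Rlt in Hk' as [Hk1 Hk2].
  apply Rmax_Rlt in Hk1 as [Hk1 Hk3]. apply Rmax_Rlt in Hk2 as [Hk2 Hk4].
  set (s := INR k) in *. assert (Hs0 : 0 < s) by lra.
  rewrite (profile_flux _ _ _ _ _ _ _ _ _ _ _ _ _ H s Hs0).
  assert (If : ex_RInt (flux_density U U1 U2 Al A1 A2 s) 0 PI).
  (* [flux_density] with its division by the radius cleared, hence jointly continuous at every
     radius, as [continuity_RInt_0_PI] asks. *)
  { pose (f := fun s t =>
      (- (exp (2 * Al (s * sin t) (s * cos t) - 2 * U (s * sin t) (s * cos t)) *
          (2 * (sin t * A1 (s * sin t) (s * cos t) + cos t * A2 (s * sin t) (s * cos t))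
           - 2 * (sin t * U1 (s * sin t) (s * cos t) + cos t * U2 (s * sin t) (s * cos t))))
       + exp (- 2 * U (s * sin t) (s * cos t)) *
          (2 * (sin t * U1 (s * sin t) (s * cos t) + cos t * U2 (s * sin t) (s * cos t))))
        * (s ^ 2 * sin t)
      + (exp (2 * Al (s * sin t) (s * cos t) - 2 * U (s * sin t) (s * cos t))
         - exp (- 2 * U (s * sin t) (s * cos t))) * (s * sin t)).
    apply (ex_RInt_ext (f s)).
    - intros t _. unfold flux_density, f.
      match goal with |- ?a = ?b => change (@eq R a b) end. field. lra.
    - apply (continuity_RInt_0_PI f). intros r' t. unfold f. cont2d. }
  assert (Im : ex_RInt (mass_density U1 U2 Al A1 A2 s) 0 PI).
  { apply (continuity_RInt_0_PI (mass_density U1 U2 Al A1 A2)). intros r' t.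
    unfold mass_density. cont2d. }
  set (mf := RInt (flux_density U U1 U2 Al A1 A2 s) 0 PI).
  set (mm := RInt (mass_density U1 U2 Al A1 A2 s) 0 PI).
  assert (E : RInt (fun t => 2 * PI * flux_density U U1 U2 Al A1 A2 s t) 0 PI = 2 * PI * mf).
  { exact (RInt_scal _ _ _ (2 * PI) If). }
  rewrite E.
  assert (HD : Rabs (mf - mm) <= PI * (K / s)).
  { assert (ED : RInt (fun t => flux_density U U1 U2 Al A1 A2 s t
        - mass_density U1 U2 Al A1 A2 s t) 0 PI = mf - mm)
      by exact (RInt_minus (V := R_CompleteNormedModule) _ _ 0 PI If Im).
    rewrite <- ED.
    apply RInt_bound.
    - now apply (ex_RInt_minus (V := R_NormedModule)).
    - intros t Ht. apply HK; trivial. lra. }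
  assert (HM : RInt (mass_density U1 U2 Al A1 A2 r) 0 PI <= mm).
  { unfold mm.
    pose proof (MVT_ge (fun r => RInt (mass_density U1 U2 Al A1 A2 r) 0 PI)
      (fun r => RInt (curvature_density U1 U11 U22 A11 A22 r) 0 PI) r s 0) as Q.
    enough ((s - r) * 0 <= RInt (mass_density U1 U2 Al A1 A2 s) 0 PI
                           - RInt (mass_density U1 U2 Al A1 A2 r) 0 PI) by lra.
    apply Q; [|lra|].
    - intros v. apply (is_derive_mass_density U U1 U2 U11 U12 U22 Al A1 A2 A11 A12 A22).
      + apply (prof_U _ _ _ _ _ _ _ _ _ _ _ _ _ H).
      + apply (prof_A _ _ _ _ _ _ _ _ _ _ _ _ _ H).
      + apply (profile_axis _ _ _ _ _ _ _ _ _ _ _ _ _ H).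
    - intros v Hv. apply RInt_ge_0; [lra | |].
      + apply (is_derive_mass_density U U1 U2 U11 U12 U22 Al A1 A2 A11 A12 A22).
        * apply (prof_U _ _ _ _ _ _ _ _ _ _ _ _ _ H).
        * apply (prof_A _ _ _ _ _ _ _ _ _ _ _ _ _ H).
        * apply (profile_axis _ _ _ _ _ _ _ _ _ _ _ _ _ H).
      + intros t Ht.
        eapply Rle_trans; [|apply (curvature_density_lower_bound U1 U2); trivial; lra].
        pose proof (sin_gt_0 t ltac:(lra) ltac:(lra)).
        apply Rmult_le_pos; [|apply pow2_ge_0].
        apply Rmult_le_pos; [lra|]. apply Rmult_le_pos; lra. }
  assert (HKs : K / s <= delta).
  { apply Rmult_le_reg_r with s; trivial.
    replace (K / s * s) with K by (field; lra).
    apply Rmult_lt_compat_l with (r := delta) in Hk4; trivial.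
    replace (delta * (K / delta)) with K in Hk4 by (field; lra). lra. }
  assert (HPI4 : PI <= 4) by apply PI_4.
  apply Rabs_le_between in HD.
  assert (PI * (K / s) <= PI * delta) by (apply Rmult_le_compat_l; lra).
  replace (/ (16 * PI) * (2 * PI * mf)) with (mf / 8) by (field; lra).
  assert (PI * delta <= 4 * delta) by (apply Rmult_le_compat_r; lra).
  lra.
Qed.

(** The exterior region is not convex, so the points are joined by a path that moves outward in
    [rho], then vertically, then back inward. It stays outside radius [R0] and, endpoints excepted,
    off the axis. *)
Lemma outside_lipschitz F F1 F2 L R0 :
  (forall x z, differentiable_pt_lim F x z (F1 x z) (F2 x z)) ->
  (forall x z, 0 < x -> R0 <= sqrt (x ^ 2 + z ^ 2) -> Rabs (F1 x z) <= L /\ Rabs (F2 x z) <= L) ->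
  forall x z x' z', 0 <= x -> 0 <= x' ->
  R0 <= sqrt (x ^ 2 + z ^ 2) -> R0 <= sqrt (x' ^ 2 + z' ^ 2) ->
  Rabs (F x z - F x' z') <= 3 * L * (Rabs (x - x') + Rabs (z - z')).
Proof.
  intros D HL x z x' z' Hx Hx' Hr Hr'.
  (* The extra [Rabs (z - z')] covers a vertical segment crossing [z = 0]: then [|z| <= |z - z'|],
     and [xM] alone reaches the radius of the first point. *)
  set (xM := Rmax x x' + Rabs (z - z')).
  assert (H1 : x <= xM) by (unfold xM; pose proof (Rmax_l x x'); pose proof (Rabs_pos (z - z')); lra).
  assert (H2 : x' <= xM) by (unfold xM; pose proof (Rmax_r x x'); pose proof (Rabs_pos (z - z')); lra).
  assert (mono : forall a b a' b', 0 <= a <= a' -> Rabs b <= Rabs b' -> R0 <= sqrt (a ^ 2 + b ^ 2) ->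
    R0 <= sqrt (a' ^ 2 + b' ^ 2)).
  { intros a b a' b' Ha Hb H. apply Rle_trans with (1 := H), sqrt_le_1_alt.
    apply Rplus_le_compat; [now apply pow_incr|].
    rewrite <- (pow2_abs b), <- (pow2_abs b'). apply pow_incr.
    split; [apply Rabs_pos | trivial]. }
  assert (hor : forall y w, 0 <= y -> y <= xM -> R0 <= sqrt (y ^ 2 + w ^ 2) ->
    Rabs (F xM w - F y w) <= L * (xM - y)).
  { intros y w Hy [Hlt|<-] Hw.
    2:{ rewrite !Rminus_diag, Rabs_R0. lra. }
    destruct (MVT_cor2 (fun t => F t w) (fun t => F1 t w) y xM Hlt) as (c & E & Hc).
    { intros c _. apply is_derive_Reals. exact (is_derive_slice1 _ _ _ _ _ (D c w)). }
    rewrite E, Rabs_mult, (Rabs_pos_eq (xM - y)) by lra.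
    apply Rmult_le_compat_r; [lra|]. apply HL; [lra|].
    apply mono with y w; trivial; [lra | apply Rle_refl]. }
  assert (ver : Rabs (F xM z - F xM z') <= L * Rabs (z - z')).
  { destruct (Req_dec z z') as [->|Hz].
    { rewrite !Rminus_diag, Rabs_R0. lra. }
    assert (HM : 0 < xM).
    { unfold xM. pose proof (Rmax_l x x').
      assert (0 < Rabs (z - z')) by (apply Rabs_pos_lt; lra). lra. }
    destruct (MVT_gen (fun t => F xM t) z' z (fun t => F2 xM t)) as (c & Hc & E).
    - intros c _. exact (is_derive_slice2 _ _ _ _ _ (D xM c)).
    - intros c _. apply continuity_pt_filterlim, (ex_derive_continuous (V := R_NormedModule)).
      eexists. exact (is_derive_slice2 _ _ _ _ _ (D xM c)).
    - rewrite E, Rabs_mult. apply Rmult_le_compat_r; [apply Rabs_pos|].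
      apply HL; trivial.
      destruct (Rle_dec (Rabs z) (Rabs c)) as [|Hzc]; [apply mono with x z; trivial; lra|].
      destruct (Rle_dec (Rabs z') (Rabs c)) as [|Hzc']; [apply mono with x' z'; trivial; lra|].
      (* [c] lies between [z] and [z'], which therefore have opposite signs. *)
      apply Rle_trans with (1 := Hr). apply sqrt_le_1_alt.
      assert (x + Rabs z <= xM).
      { unfold xM. pose proof (Rmax_l x x').
        enough (Rabs z <= Rabs (z - z')) by lra.
        unfold Rmin, Rmax in Hc. destruct (Rle_dec z' z);
        unfold Rabs in *; repeat destruct Rcase_abs; lra. }
      rewrite <- (pow2_abs z). pose proof (Rabs_pos z). pose proof (pow2_ge_0 c). nra. }
  pose proof (hor x z Hx H1 Hr) as G1. pose proof (hor x' z' Hx' H2 Hr') as G2.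
  replace (F x z - F x' z') with
    (- (F xM z - F x z) + (F xM z - F xM z') + (F xM z' - F x' z')) by ring.
  eapply Rle_trans; [apply Rabs_triang|].
  eapply Rle_trans; [apply Rplus_le_compat_r, Rabs_triang|].
  rewrite Rabs_Ropp.
  assert (HxM : (xM - x) + (xM - x') <= Rabs (x - x') + 2 * Rabs (z - z')).
  { unfold xM, Rmax. destruct (Rle_dec x x'); unfold Rabs; repeat destruct Rcase_abs; lra. }
  destruct (Rle_lt_dec 0 L) as [HL0|HL0].
  - pose proof (Rabs_pos (x - x')). pose proof (Rabs_pos (z - z')). nra.
  (* A negative [L] is absurd, since it would bound an absolute value at [(Rabs R0 + 1, 0)]. *)
  - exfalso. destruct (HL (Rabs R0 + 1) 0) as [G _].
    + pose proof (Rabs_pos R0). lra.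
    + replace ((Rabs R0 + 1) ^ 2 + 0 ^ 2) with ((Rabs R0 + 1) ^ 2) by ring.
      pose proof (Rabs_pos R0). rewrite sqrt_pow2 by lra. pose proof (Rle_abs R0). lra.
    + pose proof (Rabs_pos (F1 (Rabs R0 + 1) 0)). lra.
Qed.

(** * From integral to pointwise smallness *)

Lemma sin_cos_lipschitz a b :
  Rabs (sin a - sin b) <= Rabs (a - b) /\ Rabs (cos a - cos b) <= Rabs (a - b).
Proof.
  split.
  - destruct (MVT_gen sin b a cos) as (c & _ & E).
    + intros x _. apply is_derive_Reals, derivable_pt_lim_sin.
    + intros x _. apply continuity_sin.
    + rewrite E, Rabs_mult. pose proof (Rabs_cos_le c). pose proof (Rabs_pos (a - b)). nra.
  - destruct (MVT_gen cos b a (fun t => - sin t)) as (c & _ & E).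
    + intros x _. apply is_derive_Reals, derivable_pt_lim_cos.
    + intros x _. apply continuity_cos.
    + rewrite E, Rabs_mult, Rabs_Ropp.
      pose proof (Rabs_sin_le c). pose proof (Rabs_pos (a - b)). nra.
Qed.

Lemma polar_exists x z : 0 < x ->
  let r := sqrt (x ^ 2 + z ^ 2) in
  exists t, 0 < t < PI /\ r * sin t = x /\ r * cos t = z.
Proof.
  intros Hx r.
  assert (Hs : 0 < x ^ 2 + z ^ 2) by (pose proof (pow2_ge_0 z); nra).
  assert (Hr : 0 < r) by now apply sqrt_lt_R0.
  assert (Er : r ^ 2 = x ^ 2 + z ^ 2) by (apply pow2_sqrt; lra).
  assert (Hr0 : r <> 0) by now apply Rgt_not_eq.
  assert (Hy : (z / r) ^ 2 = 1 - (x / r) ^ 2).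
  { replace (z ^ 2) with (r ^ 2 - x ^ 2) by lra.
    replace ((z / r) ^ 2) with (z ^ 2 / r ^ 2) by (field; trivial).
    replace (z ^ 2) with (r ^ 2 - x ^ 2) by lra. field; trivial. }
  assert (Hxr : 0 < x / r) by now apply Rdiv_lt_0_compat.
  assert (Hb : -1 < z / r < 1) by (split; nra).
  exists (acos (z / r)). repeat split.
  - now apply acos_bound_lt.
  - now apply acos_bound_lt.
  - rewrite sin_acos by lra. unfold Rsqr.
    replace (1 - z / r * (z / r)) with ((x / r) ^ 2) by lra.
    rewrite sqrt_pow2 by lra. field; trivial.
  - rewrite cos_acos by lra. field; trivial.
Qed.

(* If [q > s] at a point, then [q > s / 2] on a polar box of definite size around it,
   which forces a definite increase of [T] across the box. *)
Lemma pointwise_of_increment R0 rho1 Rm L s w0 :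
  0 < R0 -> 0 < rho1 -> R0 <= Rm -> 0 <= L -> 0 < s -> 0 < w0 ->
  exists kappa, 0 < kappa /\
  forall (T : R -> R) (n q : R -> R -> R),
  (forall r, is_derive T r (RInt (n r) 0 PI) /\ ex_RInt (n r) 0 PI) ->
  T 0 = 0 -> T (Rm + 1) <= kappa ->
  (forall r t, 0 <= r -> 0 < t < PI -> 0 <= n r t) ->
  (forall r t, R0 <= r <= Rm + 1 -> 0 < t < PI -> rho1 / 2 <= r * sin t ->
     w0 * q (r * sin t) (r * cos t) <= n r t) ->
  (forall x z x' z', 0 <= x -> 0 <= x' ->
     R0 <= sqrt (x ^ 2 + z ^ 2) -> R0 <= sqrt (x' ^ 2 + z' ^ 2) ->
     Rabs (q x z - q x' z') <= L * (Rabs (x - x') + Rabs (z - z'))) ->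
  forall x z, rho1 <= x -> R0 <= sqrt (x ^ 2 + z ^ 2) <= Rm -> q x z <= s.
Proof.
  intros HR0 Hrho HRm HL Hs Hw0. pose proof PI2_1 as HPI.
  (* [h] is the side of the polar box. It displaces [rho] and [z] by at most [h * (1 + Rm)], which
     keeps [rho >= rho1 / 2] and changes [q] by at most [s / 2]. *)
  set (h := Rmin 1 (Rmin (rho1 / (2 * (1 + Rm))) (s / (4 * (L + 1) * (1 + Rm))))).
  assert (Hh : 0 < h).
  { unfold h. repeat apply Rmin_glb_lt; [lra | |]; apply Rdiv_lt_0_compat; try lra.
    apply Rmult_lt_0_compat; lra. }
  assert (Hh1 : h <= 1) by apply Rmin_l.
  assert (Hh2 : h * (1 + Rm) <= rho1 / 2).
  { apply Rle_trans with (rho1 / (2 * (1 + Rm)) * (1 + Rm)).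
    - apply Rmult_le_compat_r; [lra|]. apply Rle_trans with (1 := Rmin_r _ _), Rmin_l.
    - right. field. lra. }
  assert (Hh3 : (L + 1) * (h * (1 + Rm)) <= s / 4).
  { apply Rle_trans with ((L + 1) * (s / (4 * (L + 1) * (1 + Rm)) * (1 + Rm))).
    - apply Rmult_le_compat_l; [lra|]. apply Rmult_le_compat_r; [lra|].
      apply Rle_trans with (1 := Rmin_r _ _), Rmin_r.
    - right. field. lra. }
  clearbody h.
  set (c := w0 * (s / 2)). assert (Hc : 0 < c) by (unfold c; apply Rmult_lt_0_compat; lra).
  (* [T] grows by at least [h * (h * c)] across the box; taking half makes the contradiction
     strict. *)
  exists (h * (h * c) / 2).
  assert (Hk : 0 < h * (h * c)) by (apply Rmult_lt_0_compat, Rmult_lt_0_compat; trivial).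
  split; [lra|].
  intros T n q D T0 TR n0 nq Lq x z Hx Hr.
  destruct (Rle_lt_dec (q x z) s) as [|Hq]; trivial. exfalso.
  destruct (polar_exists x z ltac:(lra)) as (t0 & Ht0 & Ex & Ez).
  set (r0 := sqrt (x ^ 2 + z ^ 2)) in *.
  assert (mono : forall a b, 0 <= a <= b -> T a <= T b).
  { intros a b Hab.
    pose proof (MVT_ge T (fun r => RInt (n r) 0 PI) a b 0 (fun r => proj1 (D r))) as Q.
    enough ((b - a) * 0 <= T b - T a) by lra. apply Q; [lra|].
    intros r Hr'. apply RInt_ge_0; [lra | apply D |]. intros t Ht. apply n0; lra. }
  assert (Hinc : h * (h * c) <= T (r0 + h) - T r0).
  { replace h with (r0 + h - r0) at 1 by ring.
    apply (MVT_ge T (fun r => RInt (n r) 0 PI)); [intros; apply D | lra |].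
    intros r Hrr.
    (* An angular interval of length [h] containing [t0] fits into [[0, PI]] because
       [h <= 1 < PI / 2]. *)
    assert (Ha : exists a, 0 <= a /\ a + h <= PI /\ a <= t0 <= a + h).
    { destruct (Rle_dec t0 (PI / 2)); [exists t0 | exists (t0 - h)]; lra. }
    destruct Ha as (a & Ha0 & HaPI & Hat).
    replace h with (a + h - a) at 1 by ring.
    apply RInt_ge_subinterval; try lra; [apply D | intros t Ht; apply n0; lra |].
    intros t Ht.
    assert (Hdt : Rabs (t - t0) <= h) by (apply Rabs_le; lra).
    destruct (sin_cos_lipschitz t t0) as [Hsin Hcos].
    assert (disp : forall v w, Rabs w <= 1 -> Rabs (w - v) <= Rabs (t - t0) ->
      Rabs (r * w - r0 * v) <= h * (1 + Rm)).
    { intros v w Hw Hvw. replace (r * w - r0 * v) with ((r - r0) * w + r0 * (w - v)) by ring.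
      eapply Rle_trans; [apply Rabs_triang|]. rewrite !Rabs_mult.
      rewrite (Rabs_pos_eq (r - r0)), (Rabs_pos_eq r0) by lra.
      pose proof (Rabs_pos w). pose proof (Rabs_pos (w - v)). nra. }
    pose proof (disp _ _ (Rabs_sin_le t) Hsin) as Dx.
    pose proof (disp _ _ (Rabs_cos_le t) Hcos) as Dz.
    rewrite Ex in Dx. rewrite Ez in Dz.
    assert (Hx2 : rho1 / 2 <= r * sin t) by (apply Rabs_le_between in Dx; lra).
    assert (Ht' : 0 < t < PI) by lra.
    apply Rle_trans with (2 := nq r t ltac:(lra) Ht' Hx2).
    apply Rmult_le_compat_l; [lra|].
    assert (Q : Rabs (q (r * sin t) (r * cos t) - q x z)
      <= L * (Rabs (r * sin t - x) + Rabs (r * cos t - z))).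
    { apply Lq; [lra | lra | rewrite sqrt_polar by lra; lra | tauto]. }
    assert (L * (Rabs (r * sin t - x) + Rabs (r * cos t - z)) <= L * (2 * (h * (1 + Rm))))
      by (apply Rmult_le_compat_l; lra).
    apply Rabs_le_between in Q.
    assert (0 < h * (1 + Rm)) by (apply Rmult_lt_0_compat; lra). lra. }
  pose proof (mono 0 r0 ltac:(lra)). pose proof (mono (r0 + h) (Rm + 1) ltac:(lra)). lra.
Qed.

(* Integrate [F1] along a line parallel to the [rho]-axis, out to where [F] is small by decay. *)
Lemma small_of_small_derivative C L R0 R1 eta :
  0 < R0 -> 0 < C -> 0 < L -> R0 < R1 -> 0 < eta ->
  exists rho1 Rm s, 0 < rho1 /\ R0 <= Rm /\ 0 < s /\
  forall F F1 F2,
  (forall x z, differentiable_pt_lim F x z (F1 x z) (F2 x z)) ->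
  (forall x z, 0 < x -> R0 <= sqrt (x ^ 2 + z ^ 2) -> Rabs (F x z) <= C / sqrt (x ^ 2 + z ^ 2)) ->
  (forall x z, 0 < x -> R0 <= sqrt (x ^ 2 + z ^ 2) -> Rabs (F1 x z) <= L /\ Rabs (F2 x z) <= L) ->
  (forall x z, rho1 <= x -> R0 <= sqrt (x ^ 2 + z ^ 2) <= Rm -> Rabs (F1 x z) <= s) ->
  forall x z, 0 <= x -> R0 <= sqrt (x ^ 2 + z ^ 2) <= R1 -> Rabs (F x z) <= eta.
Proof.
  intros HR0 HC HL HR1 Heta.
  (* Three errors of at most [eta / 3] each: the decay bound [C / rho2], the integral of [F1] from
     [x] to [rho2], and the Lipschitz variation across the strip [x < rho1]. The radius [rho2 + R1]
     encloses all the horizontal segments used. *)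
  set (rho2 := R1 + 3 * C / eta).
  assert (H3 : 0 < 3 * C / eta) by (apply Rdiv_lt_0_compat; lra).
  assert (Hrho2 : R1 < rho2) by (unfold rho2; lra).
  set (rho1 := Rmin rho2 (eta / (9 * L))).
  assert (Hrho1 : 0 < rho1) by (apply Rmin_glb_lt; [lra | apply Rdiv_lt_0_compat; lra]).
  exists rho1, (rho2 + R1), (eta / (3 * rho2)). split; [trivial|]. split; [lra|].
  split; [apply Rdiv_lt_0_compat; lra|].
  intros F F1 F2 D HF HLip Hs.
  assert (H12 : rho1 <= rho2) by apply Rmin_l.
  assert (sqrt_mono : forall a b z, 0 <= a <= b -> sqrt (a ^ 2 + z ^ 2) <= sqrt (b ^ 2 + z ^ 2)).
  { intros a b z H. apply sqrt_le_1_alt, Rplus_le_compat_r, pow_incr, H. }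
  assert (le_sqrt : forall a b, 0 <= a -> a <= sqrt (a ^ 2 + b ^ 2)).
  { intros a b H. rewrite <- (sqrt_pow2 a H) at 1. apply sqrt_le_1_alt.
    pose proof (pow2_ge_0 b). lra. }
  assert (sqrt_le : forall a b, 0 <= a -> sqrt (a ^ 2 + b ^ 2) <= a + Rabs b).
  { intros a b H. pose proof (Rabs_pos b). rewrite <- (sqrt_pow2 (a + Rabs b)) by lra.
    apply sqrt_le_1_alt. rewrite <- (pow2_abs b). nra. }
  assert (far : forall x z, rho1 <= x <= rho2 -> Rabs z <= R1 -> R0 <= sqrt (x ^ 2 + z ^ 2) ->
    Rabs (F x z) <= 2 * eta / 3).
  { intros x z Hx Hz Hr.
    assert (E1 : Rabs (F rho2 z) <= eta / 3).
    { pose proof (le_sqrt rho2 z ltac:(lra)) as Hle.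
      pose proof (sqrt_mono x rho2 z ltac:(lra)).
      eapply Rle_trans; [apply HF; lra|].
      apply Rle_trans with (C / (3 * C / eta)).
      - apply Rmult_le_compat_l; [lra|]. apply Rinv_le_contravar; [trivial|]. unfold rho2 in Hle. unfold rho2. lra.
      - right. field. lra. }
    assert (E2 : Rabs (F rho2 z - F x z) <= eta / (3 * rho2) * (rho2 - x)).
    { destruct (MVT_gen (fun t => F t z) x rho2 (fun t => F1 t z)) as (c & Hc & E).
      - intros c _. exact (is_derive_slice1 _ _ _ _ _ (D c z)).
      - intros c _. apply continuity_pt_filterlim, (ex_derive_continuous (V := R_NormedModule) (fun t => F t z)).
        exists (F1 c z). exact (is_derive_slice1 _ _ _ _ _ (D c z)).
      - rewrite Rmin_left, Rmax_right in Hc by lra.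
        rewrite E, Rabs_mult, (Rabs_pos_eq (rho2 - x)) by lra.
        apply Rmult_le_compat_r; [lra|]. apply Hs; [lra|]. split.
        + apply Rle_trans with (1 := Hr), sqrt_mono. lra.
        + pose proof (sqrt_le c z ltac:(lra)). lra. }
    assert (E3 : eta / (3 * rho2) * (rho2 - x) <= eta / 3).
    { replace (eta / 3) with (eta / (3 * rho2) * rho2) by (field; lra).
      apply Rmult_le_compat_l; [|lra]. apply Rlt_le, Rdiv_lt_0_compat; lra. }
    replace (F x z) with (F rho2 z + - (F rho2 z - F x z)) by ring.
    eapply Rle_trans; [apply Rabs_triang|]. rewrite Rabs_Ropp. lra. }
  intros x z Hx Hr.
  assert (Hz : Rabs z <= R1).
  { pose proof (le_sqrt (Rabs z) x (Rabs_pos z)) as Q.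
    rewrite pow2_abs, Rplus_comm in Q. lra. }
  destruct (Rle_dec rho1 x) as [Hx1|Hx1].
  - assert (x <= R1) by (pose proof (le_sqrt x z Hx); lra).
    pose proof (far x z ltac:(lra) Hz ltac:(lra)). lra.
  - assert (Hr1 : R0 <= sqrt (rho1 ^ 2 + z ^ 2)).
    { apply Rle_trans with (1 := proj1 Hr), sqrt_mono. lra. }
    pose proof (far rho1 z ltac:(lra) Hz Hr1) as Q1.
    pose proof (outside_lipschitz F F1 F2 L R0 D HLip x z rho1 z Hx ltac:(lra) ltac:(lra) Hr1) as Q2.
    rewrite Rminus_diag, Rabs_R0, Rplus_0_r, (Rabs_minus_sym x rho1), (Rabs_pos_eq (rho1 - x)) in Q2 by lra.
    assert (3 * L * (rho1 - x) <= eta / 3).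
    { apply Rle_trans with (3 * L * (eta / (9 * L))).
      - apply Rmult_le_compat_l; [lra|]. pose proof (Rmin_r rho2 (eta / (9 * L))) as Q. fold rho1 in Q. lra.
      - right. field. lra. }
    replace (F x z) with ((F x z - F rho1 z) + F rho1 z) by ring.
    eapply Rle_trans; [apply Rabs_triang|]. lra.
Qed.

(** * Smallness of [u] and [alpha] for small mass *)

Lemma decay_lin C R0 F F1 F2 F11 F12 F22 G G1 G2 G11 G12 G22 a b :
  decay C R0 F F1 F2 F11 F12 F22 -> decay C R0 G G1 G2 G11 G12 G22 ->
  decay ((Rabs a + Rabs b) * C) R0 (fun x y => a * F x y + b * G x y)
    (fun x y => a * F1 x y + b * G1 x y) (fun x y => a * F2 x y + b * G2 x y)
    (fun x y => a * F11 x y + b * G11 x y) (fun x y => a * F12 x y + b * G12 x y)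
    (fun x y => a * F22 x y + b * G22 x y).
Proof.
  intros HF HG x z Hx Hr r.
  destruct (HF x z Hx Hr) as (f & (f1 & f2) & f11 & f12 & f22).
  destruct (HG x z Hx Hr) as (g & (g1 & g2) & g11 & g12 & g22).
  fold r in f, f1, f2, f11, f12, f22, g, g1, g2, g11, g12, g22.
  assert (L : forall v w c, Rabs v <= C / c -> Rabs w <= C / c ->
    Rabs (a * v + b * w) <= (Rabs a + Rabs b) * C / c).
  { intros v w c Hv Hw. eapply Rle_trans; [apply Rabs_triang|]. rewrite !Rabs_mult.
    apply Rmult_le_compat_l with (r := Rabs a) in Hv; [|apply Rabs_pos].
    apply Rmult_le_compat_l with (r := Rabs b) in Hw; [|apply Rabs_pos].
    unfold Rdiv in *. lra. }
  repeat split; now apply L.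
Qed.

Lemma decay_derivative_bound C R0 F F1 F2 F11 F12 F22 :
  0 < R0 -> 0 < C -> decay C R0 F F1 F2 F11 F12 F22 ->
  (forall x z, 0 < x -> R0 <= sqrt (x ^ 2 + z ^ 2) ->
     Rabs (F1 x z) <= C / R0 ^ 2 /\ Rabs (F2 x z) <= C / R0 ^ 2) /\
  (forall x z, 0 < x -> R0 <= sqrt (x ^ 2 + z ^ 2) ->
     Rabs (F11 x z) <= C / R0 ^ 3 /\ Rabs (F12 x z) <= C / R0 ^ 3).
Proof.
  intros HR0 HC HF.
  assert (L : forall r n, R0 <= r -> C / r ^ n <= C / R0 ^ n).
  { intros r n Hr. apply Rmult_le_compat_l; [lra|]. apply Rinv_le_contravar.
    - now apply pow_lt.
    - apply pow_incr. lra. }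
  split; intros x z Hx Hr; destruct (HF x z Hx Hr) as (_ & (f1 & f2) & f11 & f12 & _);
    split; (eapply Rle_trans; [eassumption | now apply L]).
Qed.

Lemma axial_density_bound C R0 W W1 W2 W11 W12 W22 r t :
  0 < R0 -> decay C R0 W W1 W2 W11 W12 W22 -> R0 <= r -> 0 < t < PI ->
  Rabs (axial_density W1 W2 r t) <= 2 * C / r.
Proof.
  intros HR0 HW Hr Ht.
  pose proof (sin_gt_0 t ltac:(lra) ltac:(lra)) as HS.
  assert (Hx : 0 < r * sin t) by nra.
  pose proof (sqrt_polar r t ltac:(lra)) as E.
  destruct (HW (r * sin t) (r * cos t) Hx ltac:(lra)) as (_ & (w1 & w2) & _).
  rewrite E in w1, w2. pose proof (Rabs_radial_le t _ _ _ w1 w2) as Hw.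
  unfold axial_density. rewrite !Rabs_mult.
  assert (Hwt : 0 <= weight (r * sin t) <= 1).
  { unfold weight. pose proof (weight_denom_pos (r * sin t)). pose proof (pow2_ge_0 (r * sin t)).
    split; [apply Rdiv_le_0_compat; lra|].
    apply Rmult_le_reg_r with (1 + (r * sin t) ^ 2); trivial.
    unfold Rdiv. rewrite Rmult_assoc, Rinv_l by now apply Rgt_not_eq. lra. }
  rewrite (Rabs_pos_eq (weight _)), (Rabs_pos_eq r) by lra.
  replace (2 * C / r) with (1 * (2 * (C / r ^ 2)) * r) by (field; lra).
  apply Rmult_le_compat_r; [lra|].
  apply Rmult_le_compat; try lra. apply Rabs_pos.
Qed.

(** The increment lemma is used twice: on [u_rho^2] with the mass flux, and on [-w_rho] with an
    increasing [T] made of the weighted flux of [w], a multiple of the mass flux and a quadratic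
    term from Young's inequality. Since [alpha = w + 2 u], bounds of [eta / 3] on [u] and [w]
    suffice. *)
Lemma small_profile C R0 R1 eta :
  0 < R0 -> 0 < C -> R0 < R1 -> 0 < eta ->
  exists delta, 0 < delta /\
  forall g U U1 U2 U11 U12 U22 Al A1 A2 A11 A12 A22,
  profile g U U1 U2 U11 U12 U22 Al A1 A2 A11 A12 A22 ->
  decay C R0 U U1 U2 U11 U12 U22 -> decay C R0 Al A1 A2 A11 A12 A22 ->
  (forall x z, 0 < x -> 0 <= 4 * (U11 x z + U22 x z) + 4 * U1 x z / x
     - 2 * (A11 x z + A22 x z) - 2 * (U1 x z ^ 2 + U2 x z ^ 2)) ->
  (forall x z, 0 < x -> A1 x z - 2 * U1 x z <= 0) ->
  Rbar_lt (mass g) delta ->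
  forall x z, 0 <= x -> R0 <= sqrt (x ^ 2 + z ^ 2) <= R1 ->
  Rabs (U x z) <= eta /\ Rabs (Al x z) <= eta.
Proof.
  intros HR0 HC HR1 Heta. pose proof PI_RGT_0 as HPI.
  assert (HR02 : 0 < R0 ^ 2) by now apply pow_lt.
  assert (HR03 : 0 < R0 ^ 3) by now apply pow_lt.
  set (L := 3 * C / R0 ^ 2). set (L2 := 3 * C / R0 ^ 3).
  assert (HL : 0 < L) by (apply Rdiv_lt_0_compat; lra).
  assert (HL2 : 0 < L2) by (apply Rdiv_lt_0_compat; lra).
  destruct (small_of_small_derivative (3 * C) L R0 R1 (eta / 3))
    as (rho1 & Rm & s & Hrho & HRm & Hs & small); try lra.
  set (d := 1 + (Rm + 1) ^ 2). assert (Hd : 0 < d) by apply weight_denom_pos.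
  (* A lower bound for [2 r weight' x] where [r >= R0] and [rho1 / 2 <= x <= Rm + 1]. *)
  set (w0 := 2 * R0 * (rho1 / d ^ 2)).
  assert (Hw0 : 0 < w0).
  { apply Rmult_lt_0_compat; [lra|]. apply Rdiv_lt_0_compat; [trivial | now apply pow_lt]. }
  (* The square of [U1] has Lipschitz constant [2 L * 3 L2]; the threshold [s ^ 2] returns
     [|U1| <= s]; and [R0 * rho1] bounds [2 r x] from below when [x >= rho1 / 2]. *)
  destruct (pointwise_of_increment R0 rho1 Rm (6 * L * L2) (s ^ 2) (R0 * rho1))
    as (ku & Hku & smallU); try lra.
  { apply Rmult_le_pos; lra. }
  { now apply pow_lt. }
  { now apply Rmult_lt_0_compat. }
  destruct (pointwise_of_increment R0 rho1 Rm (3 * L2) s w0)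
    as (kw & Hkw & smallW); try lra.
  (* At this radius the boundary flux of [w], at most [12 C PI / r1], and the Young term [PI / r1]
     together stay within [kw / 2]. *)
  set (r1 := Rmax (Rm + 1) (2 * (12 * C * PI + PI) / kw)).
  assert (Hr1 : Rm + 1 <= r1) by apply Rmax_l.
  assert (Hr1k : (12 * C * PI + PI) / r1 <= kw / 2).
  { assert (0 < C * PI) by now apply Rmult_lt_0_compat.
    apply Rmult_le_reg_r with (r1 * (2 / kw)).
    - apply Rmult_lt_0_compat; [lra | apply Rdiv_lt_0_compat; lra].
    - replace ((12 * C * PI + PI) / r1 * (r1 * (2 / kw)))
        with (2 * (12 * C * PI + PI) / kw) by (field; lra).
      replace (kw / 2 * (r1 * (2 / kw))) with r1 by (field; lra). apply Rmax_r. }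
  assert (Hr13 : 0 < r1 ^ 3) by (apply pow_lt; lra).
  (* The first bound puts the mass flux below [ku]; the second makes [r1^3] times it at most
     [kw / 2], the other half of the budget. *)
  exists (Rmin (ku / 16) (kw / (32 * r1 ^ 3))).
  set (delta := Rmin _ _).
  assert (Hdelta : 0 < delta) by (apply Rmin_glb_lt; apply Rdiv_lt_0_compat; lra).
  split; [trivial|].
  intros g U U1 U2 U11 U12 U22 Al A1 A2 A11 A12 A22 H HU HA Hscal Hmono Hm.
  pose proof (profile_mass C R0 delta g _ _ _ _ _ _ _ _ _ _ _ _ H HR0 HC HU HA Hscal Hdelta Hm)
    as Hmass.
  pose proof (prof_U _ _ _ _ _ _ _ _ _ _ _ _ _ H) as CU.
  pose proof (prof_A _ _ _ _ _ _ _ _ _ _ _ _ _ H) as CA.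
  pose proof (profile_axis _ _ _ _ _ _ _ _ _ _ _ _ _ H) as axis.
  pose proof (fun r => is_derive_mass_density U U1 U2 U11 U12 U22 Al A1 A2 A11 A12 A22 r CU CA axis)
    as DH.
  pose proof (C2_lin _ _ _ _ _ _ _ _ _ _ _ _ 1 (-2) CA CU) as CW.
  pose proof (decay_lin _ _ _ _ _ _ _ _ _ _ _ _ _ _ 1 (-2) HA HU) as HW.
  rewrite Rabs_R1, (Rabs_left (-2)) in HW by lra.
  replace ((1 + - -2) * C) with (3 * C) in HW by ring.
  destruct (decay_derivative_bound _ _ _ _ _ _ _ _ HR0 HC HU) as [BU1 BU2].
  destruct (decay_derivative_bound (3 * C) _ _ _ _ _ _ _ HR0 ltac:(lra) HW) as [BW1 BW2].
  fold L in BW1. fold L2 in BW2.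
  assert (HCL : C / R0 ^ 2 <= L).
  { unfold L, Rdiv. apply Rmult_le_compat_r; [apply Rlt_le, Rinv_0_lt_compat|]; lra. }
  assert (HCL2 : C / R0 ^ 3 <= L2).
  { unfold L2, Rdiv. apply Rmult_le_compat_r; [apply Rlt_le, Rinv_0_lt_compat|]; lra. }
  assert (H00 : RInt (mass_density U1 U2 Al A1 A2 0) 0 PI = 0).
  { rewrite (RInt_ext _ (fun _ => 0)).
    - rewrite RInt_const. apply Rmult_0_r.
    - intros t _. unfold mass_density. match goal with |- ?a = ?b => change (@eq R a b) end. ring. }
  assert (curv0 : forall r t, 0 <= r -> 0 < t < PI ->
    0 <= 2 * r * (r * sin t) * U1 (r * sin t) (r * cos t) ^ 2).
  { intros r t Hr Ht. pose proof (sin_gt_0 t ltac:(lra) ltac:(lra)).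
    apply Rmult_le_pos; [|apply pow2_ge_0]. apply Rmult_le_pos; [lra|]. apply Rmult_le_pos; lra. }
  (* The decay bounds hold for [x > 0]; continuity extends them to the axis, which the Lipschitz
     hypothesis of the increment lemma includes. *)
  assert (axis_ext : forall (F F1 F2 : R -> R -> R) B,
    (forall x z, differentiable_pt_lim F x z (F1 x z) (F2 x z)) ->
    (forall x z, 0 < x -> R0 <= sqrt (x ^ 2 + z ^ 2) -> Rabs (F x z) <= B) ->
    forall x z, 0 <= x -> R0 <= sqrt (x ^ 2 + z ^ 2) -> Rabs (F x z) <= B).
  { intros F F1 F2 B DF HF x z [Hx|<-] Hr; [now apply HF|].
    apply Rnot_lt_le. intros Hlt.
    destruct (differentiable_pt_lim_continuity _ _ _ _ _ (DF 0 z)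
      (mkposreal (Rabs (F 0 z) - B) ltac:(lra))) as [e He].
    pose proof (cond_pos e) as He0. cbn in He.
    specialize (He (e / 2) z). rewrite Rminus_0_r, Rminus_diag, Rabs_R0 in He.
    rewrite Rabs_pos_eq in He by lra. specialize (He ltac:(lra) He0).
    assert (HB : Rabs (F (e / 2) z) <= B).
    { apply HF; [lra|]. apply Rle_trans with (1 := Hr), sqrt_le_1_alt.
      pose proof (pow2_ge_0 (e / 2)). lra. }
    pose proof (Rabs_triang_inv (F 0 z) (F (e / 2) z)) as Q.
    rewrite Rabs_minus_sym in Q. lra. }
  assert (QU : forall x z, rho1 <= x -> R0 <= sqrt (x ^ 2 + z ^ 2) <= Rm -> Rabs (U1 x z) <= s).
  { intros x z Hx Hr.
    assert (Q : U1 x z ^ 2 <= s ^ 2).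
    { apply (smallU (fun r => RInt (mass_density U1 U2 Al A1 A2 r) 0 PI)
        (curvature_density U1 U11 U22 A11 A22) (fun x z => U1 x z ^ 2)); trivial.
      - apply Rle_trans with (1 := Hmass (Rm + 1) ltac:(lra)).
        pose proof (Rmin_l (ku / 16) (kw / (32 * r1 ^ 3)) : delta <= _). lra.
      - intros r t Hr' Ht. eapply Rle_trans; [|apply (curvature_density_lower_bound U1 U2); trivial].
        now apply curv0.
      - intros r t Hr' Ht Hx'.
        eapply Rle_trans; [|apply (curvature_density_lower_bound U1 U2); trivial; lra].
        apply Rmult_le_compat_r; [apply pow2_ge_0|]. nra.
      - intros a b a' b' Ha Ha' Hb Hb'.
        replace (U1 a b ^ 2 - U1 a' b' ^ 2) with ((U1 a b + U1 a' b') * (U1 a b - U1 a' b')) by ring.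
        rewrite Rabs_mult.
        assert (B : forall a b, 0 <= a -> R0 <= sqrt (a ^ 2 + b ^ 2) -> Rabs (U1 a b) <= L).
        { apply axis_ext with U11 U12; [apply CU|]. intros y w Hy Hw.
          apply Rle_trans with (2 := HCL). now apply BU1. }
        replace (6 * L * L2 * (Rabs (a - a') + Rabs (b - b')))
          with (2 * L * (3 * L2 * (Rabs (a - a') + Rabs (b - b')))) by ring.
        apply Rmult_le_compat; try apply Rabs_pos.
        + eapply Rle_trans; [apply Rabs_triang|].
          pose proof (B a b Ha Hb). pose proof (B a' b' Ha' Hb'). lra.
        + apply (outside_lipschitz U1 U11 U12 L2 R0); trivial; [apply CU|].
          intros y w Hy Hw. destruct (BU2 y w Hy Hw). lra. }
    apply Rabs_le. split; nra. }
  (* With this [lam] the Young term [lam PI r1^2] is [PI / r1], of the order of the boundary flux;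
     the price is a factor [r1^3] on the mass flux. *)
  set (lam := / r1 ^ 3). assert (Hlam : 0 < lam) by now apply Rinv_0_lt_compat.
  assert (QW : forall x z, rho1 <= x -> R0 <= sqrt (x ^ 2 + z ^ 2) <= Rm ->
    - (1 * A1 x z + - 2 * U1 x z) <= s).
  { pose (W1 := fun x z => 1 * A1 x z + - 2 * U1 x z).
    pose (W2 := fun x z => 1 * A2 x z + - 2 * U2 x z).
    pose (W11 := fun x z => 1 * A11 x z + - 2 * U11 x z).
    pose (W22 := fun x z => 1 * A22 x z + - 2 * U22 x z).
    pose (n := fun r t => - 2 * axial_source W1 W11 W22 r t
      + / lam * curvature_density U1 U11 U22 A11 A22 r t + 2 * lam * r).
    pose (T := fun r => - 2 * RInt (axial_density W1 W2 r) 0 PI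
      + / lam * RInt (mass_density U1 U2 Al A1 A2 r) 0 PI + lam * PI * r ^ 2).
    pose proof (fun r => is_derive_axial_density _ _ _ _ _ _ r CW) as DK.
    fold W1 W2 W11 W22 in DK.
    assert (DT : forall r, is_derive T r (RInt (n r) 0 PI) /\ ex_RInt (n r) 0 PI).
    { intros r. destruct (DK r) as [DK1 DK2]. destruct (DH r) as [DH1 DH2].
      assert (In : is_RInt (n r) 0 PI (- 2 * RInt (axial_source W1 W11 W22 r) 0 PI
        + / lam * RInt (curvature_density U1 U11 U22 A11 A22 r) 0 PI + (PI - 0) * (2 * lam * r))).
      { apply (is_RInt_plus (V := R_NormedModule) (fun t => - 2 * axial_source W1 W11 W22 r t
          + / lam * curvature_density U1 U11 U22 A11 A22 r t) (fun _ => 2 * lam * r)).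
        - apply (is_RInt_plus (V := R_NormedModule) (fun t => - 2 * axial_source W1 W11 W22 r t)
            (fun t => / lam * curvature_density U1 U11 U22 A11 A22 r t)).
          + apply (is_RInt_scal (V := R_NormedModule) _ _ _ (-2)).
            apply (RInt_correct (V := R_CompleteNormedModule)), DK2.
          + apply (is_RInt_scal (V := R_NormedModule) _ _ _ (/ lam)).
            apply (RInt_correct (V := R_CompleteNormedModule)), DH2.
        - apply (is_RInt_const (V := R_NormedModule)). }
      split; [|eexists; exact In].
      rewrite (is_RInt_unique _ _ _ _ In). unfold T.
      pose (K := fun r => RInt (axial_density W1 W2 r) 0 PI).
      pose (Hf := fun r => RInt (mass_density U1 U2 Al A1 A2 r) 0 PI).
      change (is_derive (fun r => - 2 * K r + / lam * Hf r + lam * PI * r ^ 2) r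
        (- 2 * RInt (axial_source W1 W11 W22 r) 0 PI
        + / lam * RInt (curvature_density U1 U11 U22 A11 A22 r) 0 PI + (PI - 0) * (2 * lam * r))).
      change (is_derive K r (RInt (axial_source W1 W11 W22 r) 0 PI)) in DK1.
      change (is_derive Hf r (RInt (curvature_density U1 U11 U22 A11 A22 r) 0 PI)) in DH1.
      clearbody K Hf. auto_derive.
      - repeat split; eexists; eassumption.
      - rewrite (is_derive_unique _ _ _ DK1 : Derive (fun r => K r) r = _).
        rewrite (is_derive_unique _ _ _ DH1 : Derive (fun r => Hf r) r = _). ring. }
    assert (wn : forall r t, 0 <= r -> 0 < t < PI ->
      2 * r * weight' (r * sin t) * - W1 (r * sin t) (r * cos t) <= n r t).
    { intros r t Hr Ht. exact (axial_source_lower_bound U1 U2 U11 U22 A1 A11 A22 lam r t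
        Hscal Hlam Hr Ht). }
    assert (w_nonneg : forall r t, 0 <= r -> 0 < t < PI -> 0 <= n r t).
    { intros r t Hr Ht. eapply Rle_trans; [|apply wn; trivial].
      destruct Hr as [Hr|<-]; [|lra].
      pose proof (sin_gt_0 t ltac:(lra) ltac:(lra)).
      assert (Hx : 0 < r * sin t) by now apply Rmult_lt_0_compat.
      pose proof (Hmono (r * sin t) (r * cos t) Hx) as Q.
      apply Rmult_le_pos; [apply Rmult_le_pos; [lra|]|unfold W1; lra].
      unfold weight'. apply Rdiv_le_0_compat; [lra|]. apply pow_lt, weight_denom_pos. }
    apply (smallW T n (fun x z => - W1 x z)); trivial.
    - unfold T. rewrite H00.
      rewrite (RInt_ext _ (fun _ => 0)).
      + rewrite RInt_const. unfold scal. cbn. unfold mult. cbn. ring.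
      + intros t _. unfold axial_density. match goal with |- ?a = ?b => change (@eq R a b) end. ring.
    - apply Rle_trans with (T r1).
      { pose proof (MVT_ge T (fun r => RInt (n r) 0 PI) (Rm + 1) r1 0 (fun r => proj1 (DT r))) as Q.
        enough ((r1 - (Rm + 1)) * 0 <= T r1 - T (Rm + 1)) by lra. apply Q; [lra|].
        intros r Hr. apply RInt_ge_0; [lra | apply DT |]. intros t Ht. apply w_nonneg; lra. }
      unfold T.
      assert (HK : Rabs (RInt (axial_density W1 W2 r1) 0 PI) <= PI * (2 * (3 * C) / r1)).
      { apply RInt_bound.
        - destruct (C2_continuity _ _ _ _ _ _ CW) as (_ & k1 & k2 & _).
          fold W1 in k1. fold W2 in k2.
          apply (continuity_RInt_0_PI (axial_density W1 W2)). intros r t.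
          unfold axial_density. cont2d.
        - intros t Ht. apply (axial_density_bound (3 * C) R0 _ _ _ _ _ _ r1 t HR0 HW); lra. }
      apply Rabs_le_between in HK.
      pose proof (Hmass r1 ltac:(lra)) as HM.
      unfold lam. rewrite Rinv_inv.
      apply Rmult_le_compat_l with (r := r1 ^ 3) in HM; [|lra].
      assert (r1 ^ 3 * (16 * delta) <= kw / 2).
      { apply Rle_trans with (r1 ^ 3 * (16 * (kw / (32 * r1 ^ 3)))).
        - apply Rmult_le_compat_l; [lra|]. apply Rmult_le_compat_l; [lra|]. apply Rmin_r.
        - right. field. lra. }
      assert (/ r1 ^ 3 * PI * r1 ^ 2 = PI / r1) by (field; lra).
      replace ((12 * C * PI + PI) / r1) with (2 * (PI * (2 * (3 * C) / r1)) + PI / r1) in Hr1k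
        by (field; lra).
      lra.
    - intros r t Hr Ht Hx. eapply Rle_trans; [|apply wn; trivial; lra].
      assert (Hx0 : 0 < r * sin t) by lra.
      pose proof (Hmono _ (r * cos t) Hx0) as Q.
      apply Rmult_le_compat_r; [unfold W1; lra|].
      set (y := r * sin t) in *.
      assert (Hy : y <= Rm + 1).
      { unfold y. pose proof (SIN_bound t). nra. }
      unfold w0, weight'.
      apply Rmult_le_compat; [lra | | lra |].
      + apply Rlt_le, Rdiv_lt_0_compat; [trivial | now apply pow_lt].
      + apply Rmult_le_compat; [lra | | lra |].
        * apply Rlt_le, Rinv_0_lt_compat, pow_lt, Hd.
        * apply Rinv_le_contravar; [apply pow_lt, weight_denom_pos|].
          apply pow_incr. pose proof (weight_denom_pos y). split; [lra|].
          unfold d. apply Rplus_le_compat_l, pow_incr. lra.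
    - intros a b a' b' Ha Ha' Hb Hb'.
      replace (- W1 a b - - W1 a' b') with (- (W1 a b - W1 a' b')) by ring. rewrite Rabs_Ropp.
      apply (outside_lipschitz W1 W11 (fun x z => 1 * A12 x z + - 2 * U12 x z) L2 R0); trivial.
      apply CW. }
  intros x z Hx Hr.
  assert (SU : Rabs (U x z) <= eta / 3).
  { apply (small U U1 U2); trivial.
    - apply CU.
    - intros y w Hy Hw. destruct (HU y w Hy Hw) as [Q _].
      apply Rle_trans with (1 := Q). unfold Rdiv. apply Rmult_le_compat_r; [|lra].
      apply Rlt_le, Rinv_0_lt_compat. lra.
    - intros y w Hy Hw. destruct (BU1 y w Hy Hw). lra. }
  assert (SW : Rabs (1 * Al x z + - 2 * U x z) <= eta / 3).
  { apply (small (fun x z => 1 * Al x z + - 2 * U x z) (fun x z => 1 * A1 x z + - 2 * U1 x z)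
      (fun x z => 1 * A2 x z + - 2 * U2 x z)); trivial.
    - apply CW.
    - intros y w Hy Hw. apply (HW y w Hy Hw).
    (* [QW] bounds [w_rho] from below; monotonicity gives the other side. *)
    - intros y w Hy Hw. pose proof (QW y w Hy Hw). pose proof (Hmono y w ltac:(lra)).
      apply Rabs_le. lra. }
  apply Rabs_le_between in SU, SW. split; apply Rabs_le; lra.
Qed.

(** * Hölder norms *)

(* At distance at most [d0] the Lipschitz bound controls the Hölder quotient,
   beyond [d0] the sup bound does. *)
Lemma holder_norm_small beta Lam eps :
  0 < beta < 1 -> 0 < Lam -> 0 < eps ->
  exists m, 0 < m /\ forall (D : point -> Prop) f,
  (forall p, D p -> Rabs (f p) <= m) ->
  (forall p q, D p -> D q -> Rabs (f p - f q) <= Lam * edist p q) ->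
  Rbar_le (holder_norm beta D f) eps.
Proof.
  intros Hbeta HLam Heps.
  assert (Hq : 0 < eps / (2 * Lam)) by (apply Rdiv_lt_0_compat; lra).
  (* [d0] solves [Lam * d0^(1 - beta) = eps / 2], the distance at which the Lipschitz bound on the
     quotient uses up half of [eps]. *)
  set (d0 := Rpower (eps / (2 * Lam)) (/ (1 - beta))).
  assert (Hd0 : 0 < d0) by apply exp_pos.
  assert (Ed0 : Rpower d0 (1 - beta) = eps / (2 * Lam)).
  { unfold d0. rewrite Rpower_mult, Rinv_l by lra. now apply Rpower_1. }
  pose proof (exp_pos (beta * ln d0) : 0 < Rpower d0 beta) as Hpow.
  (* Half of [eps] goes to the sup norm; beyond [d0] the quotient is at most
     [2 m / d0^beta <= eps / 2]. *)
  exists (Rmin (eps / 2) (eps / 4 * Rpower d0 beta)).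
  set (m := Rmin _ _).
  assert (Hm1 : m <= eps / 2) by apply Rmin_l.
  assert (Hm2 : m <= eps / 4 * Rpower d0 beta) by apply Rmin_r.
  split; [apply Rmin_glb_lt; [|apply Rmult_lt_0_compat]; lra|].
  intros D f Hsup HLip.
  replace (Finite eps) with (Rbar_plus (eps / 2) (eps / 2)) by (cbn; f_equal; lra).
  apply Rbar_plus_le_compat.
  - apply (proj2 (Lub_Rbar_correct _)). intros v (p & Hp & ->).
    apply Rle_trans with (1 := Hsup p Hp). exact Hm1.
  - apply (proj2 (Lub_Rbar_correct _)). intros v (p & q & Hp & Hq' & _ & ->).
    cbn. specialize (HLip p q Hp Hq').
    assert (Hd : 0 <= edist p q) by apply sqrt_pos.
    set (d := edist p q) in *.
    pose proof (exp_pos (beta * ln d) : 0 < Rpower d beta) as Hdp.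
    apply Rmult_le_reg_r with (Rpower d beta); trivial.
    unfold Rdiv at 1. rewrite Rmult_assoc, Rinv_l, Rmult_1_r by now apply Rgt_not_eq.
    (* At [d = 0] the totalized [Rpower] is still positive, and the Lipschitz bound makes the
       numerator vanish. *)
    destruct Hd as [Hd|Hd].
    2:{ rewrite <- Hd, Rmult_0_r in HLip. apply Rle_trans with (1 := HLip).
        apply Rmult_le_pos; lra. }
    destruct (Rle_lt_dec d d0) as [Hdd|Hdd].
    + apply Rle_trans with (1 := HLip).
      replace d with (Rpower d (1 - beta) * Rpower d beta) at 1.
      2:{ rewrite <- Rpower_plus. replace (1 - beta + beta) with 1 by ring. now apply Rpower_1. }
      rewrite <- Rmult_assoc. apply Rmult_le_compat_r; [lra|].
      apply Rle_trans with (Lam * Rpower d0 (1 - beta)).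
      * apply Rmult_le_compat_l; [lra|]. apply Rle_Rpower_l; lra.
      * rewrite Ed0. right. field. lra.
    + replace (f p - f q) with (f p + - f q) by ring.
      eapply Rle_trans; [apply Rabs_triang|]. rewrite Rabs_Ropp.
      pose proof (Hsup p Hp). pose proof (Hsup q Hq').
      assert (Rpower d0 beta <= Rpower d beta) by (apply Rle_Rpower_l; lra).
      apply Rle_trans with (eps / 2 * Rpower d0 beta); [lra|].
      apply Rmult_le_compat_l; lra.
Qed.

(** The reverse triangle inequality in the horizontal plane, with Cauchy-Schwarz from Lagrange's
    identity. *)
Lemma rho_of_lipschitz p q : Rabs (rho_of p - rho_of q) <= edist p q.
Proof.
  destruct p as [[x y] z], q as [[x' y'] z'].
  unfold rho_of, edist, sum3. cbn -[pow].
  set (a := sqrt (x ^ 2 + y ^ 2)). set (b := sqrt (x' ^ 2 + y' ^ 2)).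
  assert (Ea : a ^ 2 = x ^ 2 + y ^ 2) by (apply pow2_sqrt; nra).
  assert (Eb : b ^ 2 = x' ^ 2 + y' ^ 2) by (apply pow2_sqrt; nra).
  assert (Ha : 0 <= a) by apply sqrt_pos. assert (Hb : 0 <= b) by apply sqrt_pos.
  assert (CS : x * x' + y * y' <= a * b).
  { apply Rle_trans with (1 := Rle_abs _). rewrite <- (Rabs_pos_eq (a * b)) by nra.
    apply Rsqr_le_abs_0. unfold Rsqr.
    replace (a * b * (a * b)) with (a ^ 2 * b ^ 2) by ring. rewrite Ea, Eb.
    pose proof (pow2_ge_0 (x * y' - y * x')). nra. }
  rewrite <- (sqrt_pow2 (Rabs (a - b))) by apply Rabs_pos.
  apply sqrt_le_1_alt. rewrite pow2_abs. pose proof (pow2_ge_0 (z - z')). nra.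
Qed.

Lemma z_of_lipschitz p q : Rabs (z_of p - z_of q) <= edist p q.
Proof.
  destruct p as [[x y] z], q as [[x' y'] z'].
  unfold z_of, edist, sum3. cbn -[pow].
  rewrite <- (sqrt_pow2 (Rabs (z - z'))) by apply Rabs_pos.
  apply sqrt_le_1_alt. rewrite pow2_abs.
  pose proof (pow2_ge_0 (x - x')). pose proof (pow2_ge_0 (y - y')). lra.
Qed.

Lemma enorm_cyl p : enorm p = sqrt (rho_of p ^ 2 + z_of p ^ 2).
Proof.
  unfold enorm, rho_of, z_of, sum3. rewrite pow2_sqrt; [reflexivity|].
  pose proof (pow2_ge_0 (coord c1 p)). pose proof (pow2_ge_0 (coord c2 p)). lra.
Qed.

(** Factor out [e^b]; since [|a - b| <= 2 M], the bounds [e^M] and [e^(2 M)] combine to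
    [e^(3 M)]. *)
Lemma exp_lipschitz a b M : Rabs a <= M -> Rabs b <= M ->
  Rabs (exp a - exp b) <= exp (3 * M) * Rabs (a - b).
Proof.
  intros Ha Hb.
  replace (exp a - exp b) with (exp b * (exp (a - b) - 1)).
  2:{ replace (exp a) with (exp b * exp (a - b)) by (rewrite <- exp_plus; f_equal; ring). ring. }
  assert (Hab : Rabs (a - b) <= 2 * M).
  { replace (a - b) with (a + - b) by ring.
    eapply Rle_trans; [apply Rabs_triang|]. rewrite Rabs_Ropp. lra. }
  pose proof (exp_first_order _ _ Hab) as Q.
  rewrite Rabs_mult, (Rabs_pos_eq (exp b)) by (left; apply exp_pos).
  replace (3 * M) with (M + 2 * M) by ring. rewrite exp_plus.
  replace (exp M * exp (2 * M) * Rabs (a - b)) with (exp M * (Rabs (a - b) * exp (2 * M))) by ring.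
  apply Rmult_le_compat; trivial; [left; apply exp_pos | apply Rabs_pos |].
  apply Rabs_le_between in Hb as [_ [Hb|Hb]]; [|rewrite Hb; apply Rle_refl].
  left. now apply exp_increasing.
Qed.

Lemma profile_cyl_dist g U U1 U2 U11 U12 U22 Al A1 A2 A11 A12 A22
    (H : profile g U U1 U2 U11 U12 U22 Al A1 A2 A11 A12 A22) i j x z :
  0 <= x ->
  cyl g i j x z - cyl_euclid i j x z =
    diag_form i j (exp (2 * Al x z - 2 * U x z) - 1) (x ^ 2 * (exp (- 2 * U x z) - 1)).
Proof.
  intros Hx. rewrite (prof_cyl _ _ _ _ _ _ _ _ _ _ _ _ _ H) by trivial.
  destruct i, j; unfold cyl_euclid, kron; cbn -[pow]; ring.
Qed.

Lemma diag_form_small eta R1 x a v :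
  0 <= eta <= 1 -> 0 <= x <= R1 -> Rabs a <= eta -> Rabs v <= eta ->
  forall i j, Rabs (diag_form i j (exp (2 * a - 2 * v) - 1) (x ^ 2 * (exp (- 2 * v) - 1)))
    <= eta * (4 * exp 4 * (1 + R1 ^ 2)).
Proof.
  intros Heta Hx Ha Hv i j.
  assert (P : Rabs (2 * a - 2 * v) <= 4 * eta).
  { apply Rabs_le. apply Rabs_le_between in Ha, Hv. lra. }
  assert (Q : Rabs (- 2 * v) <= 4 * eta).
  { apply Rabs_le. apply Rabs_le_between in Hv. lra. }
  pose proof (exp_first_order _ 4 (Rle_trans _ (4 * eta) 4 P ltac:(lra))) as P1.
  pose proof (exp_first_order _ 4 (Rle_trans _ (4 * eta) 4 Q ltac:(lra))) as Q1.
  pose proof (exp_pos 4) as E.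
  assert (P2 : Rabs (exp (2 * a - 2 * v) - 1) <= 4 * eta * exp 4)
    by (apply Rle_trans with (1 := P1), Rmult_le_compat_r; lra).
  assert (Q2 : Rabs (exp (- 2 * v) - 1) <= 4 * eta * exp 4)
    by (apply Rle_trans with (1 := Q1), Rmult_le_compat_r; lra).
  assert (B0 : 0 <= 4 * eta * exp 4) by (apply Rmult_le_pos; lra).
  assert (HR : x ^ 2 <= R1 ^ 2) by (now apply pow_incr).
  pose proof (pow2_ge_0 x) as Hx2.
  replace (eta * (4 * exp 4 * (1 + R1 ^ 2))) with (4 * eta * exp 4 * (1 + R1 ^ 2)) by ring.
  assert (K1 : Rabs (exp (2 * a - 2 * v) - 1) <= 4 * eta * exp 4 * (1 + R1 ^ 2)) by nra.
  assert (K2 : Rabs (x ^ 2 * (exp (- 2 * v) - 1)) <= 4 * eta * exp 4 * (1 + R1 ^ 2)).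
  { rewrite Rabs_mult, (Rabs_pos_eq (x ^ 2)) by trivial. rewrite Rmult_comm.
    apply Rmult_le_compat; trivial; [apply Rabs_pos | lra]. }
  assert (K0 : Rabs 0 <= 4 * eta * exp 4 * (1 + R1 ^ 2)) by (rewrite Rabs_R0; nra).
  destruct i, j; cbn [diag_form]; trivial.
Qed.

Lemma diag_form_lipschitz R1 L d x a v x' a' v' :
  0 <= x <= R1 -> 0 <= x' <= R1 -> 0 <= L -> 0 <= d ->
  Rabs a <= 1 -> Rabs v <= 1 -> Rabs a' <= 1 -> Rabs v' <= 1 ->
  Rabs (x - x') <= d -> Rabs (a - a') <= L * d -> Rabs (v - v') <= L * d ->
  forall i j,
  Rabs (diag_form i j (exp (2 * a - 2 * v) - 1) (x ^ 2 * (exp (- 2 * v) - 1))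
        - diag_form i j (exp (2 * a' - 2 * v') - 1) (x' ^ 2 * (exp (- 2 * v') - 1)))
    <= (4 * exp 12 * L * (1 + R1 ^ 2) + 8 * exp 4 * R1) * d.
Proof.
  intros Hx Hx' HL Hd Ha Hv Ha' Hv' Dx Da Dv i j.
  assert (P : Rabs (2 * a - 2 * v) <= 4)
    by (apply Rabs_le; apply Rabs_le_between in Ha, Hv; lra).
  assert (P' : Rabs (2 * a' - 2 * v') <= 4)
    by (apply Rabs_le; apply Rabs_le_between in Ha', Hv'; lra).
  assert (Q : Rabs (- 2 * v) <= 4) by (apply Rabs_le; apply Rabs_le_between in Hv; lra).
  assert (Q' : Rabs (- 2 * v') <= 4) by (apply Rabs_le; apply Rabs_le_between in Hv'; lra).
  assert (HLd : 0 <= L * d) by now apply Rmult_le_pos.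
  pose proof (exp_lipschitz _ _ _ P P') as P1. pose proof (exp_lipschitz _ _ _ Q Q') as Q1.
  replace (3 * 4) with 12 in P1, Q1 by ring.
  pose proof (exp_pos 4) as E4. pose proof (exp_pos 12) as E12.
  assert (P2 : Rabs (exp (2 * a - 2 * v) - exp (2 * a' - 2 * v')) <= 4 * exp 12 * L * d).
  { apply Rle_trans with (1 := P1).
    replace (4 * exp 12 * L * d) with (exp 12 * (4 * (L * d))) by ring.
    apply Rmult_le_compat_l; [lra|].
    apply Rabs_le. apply Rabs_le_between in Da, Dv. lra. }
  assert (Q2 : Rabs (exp (- 2 * v) - exp (- 2 * v')) <= 4 * exp 12 * L * d).
  { apply Rle_trans with (1 := Q1).
    replace (4 * exp 12 * L * d) with (exp 12 * (4 * (L * d))) by ring.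
    apply Rmult_le_compat_l; [lra|].
    apply Rabs_le. apply Rabs_le_between in Dv. lra. }
  assert (HR : x ^ 2 <= R1 ^ 2) by (now apply pow_incr).
  assert (B : 0 <= 4 * exp 12 * L * d).
  { apply Rle_trans with (2 := Q2), Rabs_pos. }
  assert (B' : 0 <= 8 * exp 4 * R1 * d) by (repeat apply Rmult_le_pos; lra).
  pose proof (pow2_ge_0 R1) as HR1. pose proof (pow2_ge_0 x) as Hx2.
  replace ((4 * exp 12 * L * (1 + R1 ^ 2) + 8 * exp 4 * R1) * d)
    with (4 * exp 12 * L * d * (1 + R1 ^ 2) + 8 * exp 4 * R1 * d) by ring.
  assert (K0 : Rabs (0 - 0) <= 4 * exp 12 * L * d * (1 + R1 ^ 2) + 8 * exp 4 * R1 * d).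
  { rewrite Rminus_0_r, Rabs_R0. nra. }
  assert (K1 : Rabs ((exp (2 * a - 2 * v) - 1) - (exp (2 * a' - 2 * v') - 1))
    <= 4 * exp 12 * L * d * (1 + R1 ^ 2) + 8 * exp 4 * R1 * d).
  { replace ((exp (2 * a - 2 * v) - 1) - (exp (2 * a' - 2 * v') - 1))
      with (exp (2 * a - 2 * v) - exp (2 * a' - 2 * v')) by ring. nra. }
  assert (K2 : Rabs (x ^ 2 * (exp (- 2 * v) - 1) - x' ^ 2 * (exp (- 2 * v') - 1))
    <= 4 * exp 12 * L * d * (1 + R1 ^ 2) + 8 * exp 4 * R1 * d).
  (* Separates the variation of the exponential from that of [x^2]; the latter meets
     [|e^(-2 v') - 1| <= 4 e^4]. *)
  { replace (x ^ 2 * (exp (- 2 * v) - 1) - x' ^ 2 * (exp (- 2 * v') - 1))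
      with (x ^ 2 * (exp (- 2 * v) - exp (- 2 * v')) + (x + x') * (x - x') * (exp (- 2 * v') - 1))
      by ring.
    eapply Rle_trans; [apply Rabs_triang|]. rewrite !Rabs_mult.
    rewrite (Rabs_pos_eq (x ^ 2)), (Rabs_pos_eq (x + x')) by lra.
    apply Rplus_le_compat.
    - rewrite Rmult_comm. apply Rmult_le_compat; trivial; [apply Rabs_pos | lra].
    - replace (8 * exp 4 * R1 * d) with (2 * R1 * d * (4 * exp 4)) by ring.
      apply Rmult_le_compat; [| apply Rabs_pos | |].
      + apply Rmult_le_pos; [lra | apply Rabs_pos].
      + apply Rmult_le_compat; trivial; [lra | apply Rabs_pos | lra].
      + pose proof (exp_first_order _ _ Q') as T. nra. }
  destruct i, j; cbn [diag_form]; trivial.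
Qed.

Theorem theorem1p9 (M : axisym_metric -> Prop) (R0 : R) (R0_pos : 0 < R0)
    (M_scal : forall g : axisym_metric, M g -> nonneg_scalar_curvature g)
    (M_flat : uniformly_asymptotically_flat M R0)
    (M_mono : radially_monotone M)
    (M_AB : forall g : axisym_metric, M g ->
       forall rho z : R, 0 <= rho -> A g rho z = 0 /\ B g rho z = 0)
    (R1 : R) (R01 : R0 < R1)
    (beta : R) (beta_range : 0 < beta < 1)
    (eps : R) (eps_pos : 0 < eps) :
  exists delta : R, 0 < delta /\
    forall g : axisym_metric, M g ->
      Rbar_lt (mass g) delta ->
      Rbar_lt (holder_dist_euclid beta (annulus R0 R1) g) eps.
Proof.
  destruct (flat_decay M R0 R0_pos M_flat) as (C & HC & Hdecay).
  (* [outside_lipschitz] gives [3 * (C / R0^2)] against a sum of two coordinate differences, each at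
     most the Euclidean distance. *)
  set (L := 6 * (C / R0 ^ 2)).
  assert (HL : 0 < L).
  { apply Rmult_lt_0_compat; [lra|]. apply Rdiv_lt_0_compat; [trivial | now apply pow_lt]. }
  pose proof (exp_pos 4) as E4. pose proof (exp_pos 12) as E12.
  assert (HLam : 0 < 4 * exp 12 * L * (1 + R1 ^ 2) + 8 * exp 4 * R1).
  { assert (0 < 4 * exp 12 * L) by (apply Rmult_lt_0_compat; lra).
    assert (0 < 8 * exp 4 * R1) by (apply Rmult_lt_0_compat; lra).
    pose proof (Rmult_lt_0_compat _ _ H (weight_denom_pos R1)). lra. }
  (* Nine components of norm at most [eps / 10] leave the final inequality strict. *)
  destruct (holder_norm_small beta _ (eps / 10) beta_range HLam ltac:(lra)) as (m & Hm & holder).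
  assert (HB : 0 < 4 * exp 4 * (1 + R1 ^ 2)).
  { apply Rmult_lt_0_compat; [lra | apply weight_denom_pos]. }
  (* The bound 1 keeps the exponents in the range where [diag_form_small] and [diag_form_lipschitz]
     have fixed constants; the other makes each component at most [m]. *)
  set (eta := Rmin 1 (m / (4 * exp 4 * (1 + R1 ^ 2)))).
  assert (Heta : 0 < eta) by (apply Rmin_glb_lt; [lra | now apply Rdiv_lt_0_compat]).
  assert (Heta1 : eta <= 1) by apply Rmin_l.
  assert (Hetam : eta * (4 * exp 4 * (1 + R1 ^ 2)) <= m).
  { apply Rle_trans with (m / (4 * exp 4 * (1 + R1 ^ 2)) * (4 * exp 4 * (1 + R1 ^ 2))).
    - apply Rmult_le_compat_r; [lra | apply Rmin_r].
    - right. field. split; apply Rgt_not_eq; [apply weight_denom_pos | trivial]. }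
  destruct (small_profile C R0 R1 eta R0_pos HC R01 Heta) as (delta & Hdelta & small).
  exists delta. split; [trivial|]. intros g Hg Hmass.
  destruct (profile_exists g (M_AB g Hg))
    as (U & U1 & U2 & U11 & U12 & U22 & Al & A1 & A2 & A11 & A12 & A22 & H).
  destruct (Hdecay _ _ _ _ _ _ _ _ _ _ _ _ _ Hg H) as [HU HA].
  assert (Hscal : forall x z, 0 < x -> 0 <= 4 * (U11 x z + U22 x z) + 4 * U1 x z / x
     - 2 * (A11 x z + A22 x z) - 2 * (U1 x z ^ 2 + U2 x z ^ 2)).
  { intros x z Hx. pose proof (M_scal g Hg (x, z, 0) Hx) as Q.
    rewrite (profile_scalar _ _ _ _ _ _ _ _ _ _ _ _ _ H) in Q by exact Hx. cbn -[pow] in Q.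
    apply Rmult_le_reg_l with (1 := exp_pos (2 * U x z - 2 * Al x z)). rewrite Rmult_0_r. exact Q. }
  assert (Hmono : forall x z, 0 < x -> A1 x z - 2 * U1 x z <= 0).
  { intros x z Hx. apply (profile_monotone _ _ _ _ _ _ _ _ _ _ _ _ _ H); trivial.
    now apply (M_mono g Hg x Hx). }
  pose proof (small g _ _ _ _ _ _ _ _ _ _ _ _ H HU HA Hscal Hmono Hmass) as Hsmall.
  destruct (decay_derivative_bound _ _ _ _ _ _ _ _ R0_pos HC HU) as [BU _].
  destruct (decay_derivative_bound _ _ _ _ _ _ _ _ R0_pos HC HA) as [BA _].
  pose proof (outside_lipschitz U U1 U2 _ R0 (C2_d _ _ _ _ _ _ (prof_U _ _ _ _ _ _ _ _ _ _ _ _ _ H)) BU)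
    as LU.
  pose proof (outside_lipschitz Al A1 A2 _ R0 (C2_d _ _ _ _ _ _ (prof_A _ _ _ _ _ _ _ _ _ _ _ _ _ H)) BA)
    as LA.
  assert (Hin : forall p, annulus R0 R1 p -> 0 <= rho_of p <= R1 /\
    R0 <= sqrt (rho_of p ^ 2 + z_of p ^ 2) <= R1).
  { intros p Hp. unfold annulus in Hp. rewrite enorm_cyl in Hp.
    assert (Hr : 0 <= rho_of p) by apply sqrt_pos.
    repeat split; try lra.
    apply Rle_trans with (sqrt (rho_of p ^ 2 + z_of p ^ 2)); [|lra].
    rewrite <- (sqrt_pow2 (rho_of p)) at 1 by trivial. apply sqrt_le_1_alt.
    pose proof (pow2_ge_0 (z_of p)). lra. }
  assert (comp : forall i j, Rbar_le (holder_norm beta (annulus R0 R1) (fun p =>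
      cyl g i j (rho_of p) (z_of p) - cyl_euclid i j (rho_of p) (z_of p))) (eps / 10)).
  { intros i j. apply holder.
    - intros p Hp. destruct (Hin p Hp) as [Hr1 Hr2].
      destruct (Hsmall _ _ (proj1 Hr1) Hr2) as [SU SA].
      rewrite (profile_cyl_dist _ _ _ _ _ _ _ _ _ _ _ _ _ H) by lra.
      apply Rle_trans with (2 := Hetam). apply diag_form_small; trivial. lra.
    - intros p q Hp Hq. destruct (Hin p Hp) as [Hp1 Hp2]. destruct (Hin q Hq) as [Hq1 Hq2].
      destruct (Hsmall _ _ (proj1 Hp1) Hp2) as [SU SA].
      destruct (Hsmall _ _ (proj1 Hq1) Hq2) as [SU' SA'].
      rewrite !(profile_cyl_dist _ _ _ _ _ _ _ _ _ _ _ _ _ H) by lra.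
      pose proof (rho_of_lipschitz p q) as Dr. pose proof (z_of_lipschitz p q) as Dz.
      assert (Hd : 0 <= C / R0 ^ 2) by (unfold L in HL; lra).
      assert (Hsum : 3 * (C / R0 ^ 2) * (Rabs (rho_of p - rho_of q) + Rabs (z_of p - z_of q))
        <= L * edist p q).
      { replace (L * edist p q) with (3 * (C / R0 ^ 2) * (edist p q + edist p q))
          by (unfold L; ring).
        apply Rmult_le_compat_l; lra. }
      apply diag_form_lipschitz; trivial; try lra.
      + apply sqrt_pos.
      + eapply Rle_trans; [apply LA | exact Hsum]; lra.
      + eapply Rle_trans; [apply LU | exact Hsum]; lra. }
  apply Rbar_le_lt_trans with (9 * (eps / 10)); [|cbn; lra].
  unfold holder_dist_euclid, Rbar_sum3.
  set (e := eps / 10) in *.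
  replace (Finite (9 * e)) with
    (Rbar_plus (Rbar_plus (Rbar_plus (Rbar_plus e e) e) (Rbar_plus (Rbar_plus e e) e))
       (Rbar_plus (Rbar_plus e e) e)) by (cbn; f_equal; ring).
  repeat apply Rbar_plus_le_compat; apply comp.
Qed.
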